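(* Let $n,r\in\mathbb{N}$ with $n,r\ge 1$ and let $\vec n=(n_1,\dots,n_r)\in\mathcal S^r$ be the multi-index with $|\vec n|=n$. Let $a_i\in\mathbb{C}$, $b_i\in\mathbb{R}$ ($1\le i\le r$), $c>0$ and $d_1,d_2:\{1,\dots,r\}\to\{0,1\}$ be such that $d_1(i)=1$ for all $i$ or $d_2(i)=1$ for all $i$. Suppose that $w_{1,1},\dots,w_{1,r}\in L^1_{\mathcal M,\Sigma}(\mathbb{R}_{>0})$ are real-valued with, for all $j\in\{1,\dots,r\}$, $$\mathcal{M}w_{1,j}(s)=c^s\prod_{i=1}^r\frac{\Gamma(s+a_i)^{d_1(i)}}{\Gamma(s+b_i)^{d_2(i)}}\;\frac{s^{j-1}}{\prod_{i=1}^j(s+b_i)^{d_2(i)}},\qquad s\in\Sigma,$$ and that $\omega_{1,n}\in L^1_{\mathcal M,\Sigma}(\mathbb{R}_{>0})$ satisfies $$\mathcal{M}\omega_{1,n}(s)=c^s\prod_{i=1}^r\frac{\Gamma(s+a_i)^{d_1(i)}}{\Gamma(s+b_i+n_i)^{d_2(i)}},\qquad s\in\Sigma.$$ Then $\mathrm{MOPE}[n;w_{1,1},\dots,w_{1,r}]=\mathrm{PE}_{\mathrm{MDT}}[n;\omega_{1,n}]$; that is, the multiple orthogonal polynomial ensemble $\mathrm{MOPE}[n;w_{1,1},\dots,w_{1,r}]$ is of multiplicative derivative type with respect to $\omega_{1,n}$.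
   Context: $\Sigma\subset\mathbb{R}_{>0}$ is a (non-degenerate) interval with $\mathbb{Z}_{\ge1}\subset\Sigma$, and $L^1_{\mathcal M,\Sigma}(\mathbb{R}_{>0})=\{f:\mathbb{R}_{>0}\to\mathbb{C}\mid\int_0^\infty|f(x)x^{s-1}|dx<\infty,\ s\in\Sigma\}$; functions equal a.e. are identified. The Mellin transform is $\mathcal{M}f(s)=\int_0^\infty f(x)x^{s-1}dx$. A factor with exponent $0$ is $1$. Step-line: $\mathcal S^r=\{\vec n\in\mathbb{Z}_{\ge0}^r\mid n_1\ge\dots\ge n_r\ge n_1-1\}$, $|\vec n|=n_1+\dots+n_r$; for each $n$ there is a unique $\vec n\in\mathcal S^r$ with $|\vec n|=n$. Polynomial ensemble: for $v_1,\dots,v_n:\mathbb{R}\to\mathbb{R}$ with $x^{k-1}v_j(x)\in L^1(\mathbb{R})$ for all $j,k\in\{1,\dots,n\}$, $\mathrm{PE}[v_1,\dots,v_n]$ is the probability density on $\mathbb{R}^n$ given by $\frac1{Z_n}\prod_{1\le j<k\le n}(x_k-x_j)\det[v_j(x_k)]_{j,k=1}^n\ge0$ with normalization constant $Z_n\in\mathbb{R}\setminus\{0\}$ (so the notation presupposes that this is a well-defined probability density; in particular $v_1,\dots,v_n$ are linearly independent). Functions on $\mathbb{R}_{>0}$ are extended by $0$. $\mathrm{PE}[v_1,\dots,v_n]=\mathrm{MOPE}[n;w_1,\dots,w_r]$ means $\mathrm{span}\{v_j\}_{j=1}^n=\mathrm{span}\{x^{k-1}w_j(x)\mid k=1,\dots,n_j,\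 j=1,\dots,r\}$ for the unique $\vec n\in\mathcal S^r$ with $|\vec n|=n$. The symbol $\mathrm{MOPE}[n;w_1,\dots,w_r]$ presupposes that the associated polynomial ensemble is well defined. Functions $v_1,\dots,v_n:\mathbb{R}_{>0}\to\mathbb{R}$ are of multiplicative derivative type w.r.t. $\omega\in C^{n-2}(\mathbb{R}_{>0})$ with $\omega^{(n-2)}$ locally absolutely continuous on $\mathbb{R}_{>0}$ (no regularity condition if $n=1$) if $\mathrm{span}\{v_j(x)\}_{j=1}^n=\mathrm{span}\{(x\frac{d}{dx})^{j-1}[\omega(x)]\}_{j=1}^n$ for a.e. $x>0$ (equality of spans of functions, a.e.). In that case $\mathrm{PE}[v_1,\dots,v_n]$ (when it is a polynomial ensemble) is said to be of multiplicative derivative type and one writes $\mathrm{PE}[v_1,\dots,v_n]=\mathrm{PE}_{\mathrm{MDT}}[n;\omega]$. *)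

(* Defs.v *)
From HB Require Import structures.
From mathcomp Require Import all_boot all_order all_algebra.
From mathcomp Require Import all_classical all_reals all_analysis.
From mathcomp Require Import complex.

Set Implicit Arguments.
Unset Strict Implicit.
Unset Printing Implicit Defensive.

Import Order.TTheory GRing.Theory Num.Theory.
Import numFieldNormedType.Exports.

Local Open Scope classical_set_scope.
Local Open Scope ring_scope.
Local Open Scope complex_scope.

Section Gamma.
Context {R : realType}.

Definition cexp (z : R[i]) : R[i] :=
  (expR (complex.Re z) * cos (complex.Im z))
    +i* (expR (complex.Re z) * sin (complex.Im z)).

(* N! N^z / (z (z + 1) ... (z + N)) *)
Definition gauss_gamma (z : R[i]) (N : nat) : (R[i])^o :=
  (N`!)%:R * cexp (z * (ln (N%:R : R))%:C) / \prod_(k < N.+1) (z + k%:R).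

(* Gauss's limit formula.  At a pole the terms are eventually x / 0 = 0, so
   Gamma z = 0 there and (Gamma z)^-1 = 0 is the value of the entire
   function 1/Gamma. *)
Definition Gamma (z : R[i]) : R[i] := limn (gauss_gamma z).

Definition Gamma_pole (z : R[i]) : Prop := exists m : nat, z = - m%:R.

End Gamma.

Section Mellin.
Context {R : realType}.
Let mu : {measure set _ -> \bar R} := @lebesgue_measure R.

(* Functions on R_{>0} are functions on R whose values on ]-oo, 0] are never
   used. *)

(* An interval in R_{>0} containing all positive integers (and therefore
   automatically non-degenerate). *)
Definition mellin_domain (Sigma : set R) : Prop :=
  [/\ is_interval Sigma, forall s, Sigma s -> 0 < s
    & forall k : nat, (0 < k)%N -> Sigma k%:R].

Definition L1_mellin (Sigma : set R) (f : R -> R[i]) : Prop :=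
  [/\ measurable_fun (`]0, +oo[ : set R) (fun x : R => complex.Re (f x) : R),
      measurable_fun (`]0, +oo[ : set R) (fun x : R => complex.Im (f x) : R)
    & forall s, Sigma s ->
      (\int[mu]_(x in `]0%R, +oo[)
         (ComplexField.Normc.normc (f x * (x `^ (s - 1))%:C))%:E < +oo)%E].

Definition mellin (f : R -> R[i]) (s : R) : R[i] :=
  (\int[mu]_(x in `]0, +oo[) complex.Re (f x * (x `^ (s - 1))%:C))
    +i* (\int[mu]_(x in `]0, +oo[) complex.Im (f x * (x `^ (s - 1))%:C)).

End Mellin.

(* Lebesgue measure on R^n, with R^n represented by n.-tuple R: the image of
   the product of Lebesgue measures on R and R^n under (x, t) |-> x :: t. *)
Section LebesgueTuple.
Context {R : realType}.
Local Notation T := (measurableTypeR R).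

Definition cons_pair n (p : T * n.-tuple T) : n.+1.-tuple T :=
  [the n.+1.-tuple T of p.1 :: p.2].

Lemma measurable_cons_pair n : measurable_fun setT (@cons_pair n).
Proof. by apply: measurable_cons; [exact: measurable_fst|exact: measurable_snd]. Qed.

Section step.
Variables (n : nat) (m : {sigma_finite_measure set (n.-tuple T) -> \bar R}).

Definition cons_measure : set (n.+1.-tuple T) -> \bar R :=
  pushforward ((@lebesgue_measure R) \x m)%E (@cons_pair n).

Let mpre A : measurable A -> measurable (@cons_pair n @^-1` A).
Proof.
by move=> mA; rewrite -[X in measurable X]setTI; exact: measurable_cons_pair.
Qed.

Let cons_measure0 : cons_measure set0 = 0%E.
Proof. by rewrite /cons_measure /pushforward preimage_set0 measure0. Qed.

Let cons_measure_ge0 A : (0 <= cons_measure A)%E.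
Proof. by rewrite /cons_measure /pushforward; exact: measure_ge0. Qed.

Let cons_measure_sigma_additive : semi_sigma_additive cons_measure.
Proof.
move=> F mF tF mUF; rewrite /cons_measure /pushforward preimage_bigcup.
apply: measure_semi_sigma_additive.
- by move=> k; exact: mpre.
- apply/trivIsetP => /= i j _ _ ij; rewrite -preimage_setI.
  by move/trivIsetP : tF => /(_ _ _ _ _ ij) ->//; rewrite preimage_set0.
- by rewrite -preimage_bigcup; exact: mpre.
Qed.

HB.instance Definition _ := isMeasure.Build _ _ _ cons_measure
  cons_measure0 cons_measure_ge0 cons_measure_sigma_additive.

Let cons_measure_sigma_finite : sigma_finite setT cons_measure.
Proof.
have /sigma_finiteP[F [TF ndF Foo]] := sigma_finiteT (@lebesgue_measure R).
have /sigma_finiteP[G [TG ndG Goo]] := sigma_finiteT m.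
exists (fun k => [set t | F k (thead t) /\ G k [tuple of behead t]]).
  apply/esym; rewrite -subTset => t _ /=.
  have [i _ Fi] : (\bigcup_k F k) (thead t) by rewrite -TF.
  have [j _ Gj] : (\bigcup_k G k) [tuple of behead t] by rewrite -TG.
  exists (maxn i j) => //=; split.
  - by move: Fi; exact/subsetPset/ndF/leq_maxl.
  - by move: Gj; exact/subsetPset/ndG/leq_maxr.
move=> k; have [mF Fk] := Foo k; have [mG Gk] := Goo k; split.
  apply: measurableI; rewrite -[X in measurable X]setTI.
  - exact: (measurable_tnth (ord0 : 'I_n.+1)).
  - exact: measurable_behead.
rewrite /cons_measure /pushforward (_ : _ @^-1` _ = F k `*` G k).
  by rewrite product_measure1E// lte_mul_pinfty// ge0_fin_numE.
apply/funext => -[x t] /=.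
by congr (F k _ /\ G k _); exact: val_inj.
Qed.

HB.instance Definition _ := Measure_isSigmaFinite.Build _ _ _ cons_measure
  cons_measure_sigma_finite.

End step.

Fixpoint lebesgue_tuple n : {sigma_finite_measure set (n.-tuple T) -> \bar R} :=
  match n with
  | 0 => \d_[tuple]
  | n'.+1 => cons_measure (lebesgue_tuple n')
  end.

End LebesgueTuple.

Section Ensembles.
Context {R : realType}.
Let mu : {measure set _ -> \bar R} := @lebesgue_measure R.

Definition PE_density n (v : 'I_n -> R -> R) (Z : R)
    (x : n.-tuple (measurableTypeR R)) : R :=
  Z^-1 * (\prod_(k < n) \prod_(j < n | (j < k)%N) (tnth x k - tnth x j))
    * \det (\matrix_(j < n, k < n) v j (tnth x k)).

(* PE[v_1, ..., v_n] is well defined.  Functions being identified when equal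
   almost everywhere, so is positivity of the density. *)
Definition is_PE n (v : 'I_n -> R -> R) : Prop :=
  (forall j k : 'I_n, mu.-integrable setT (fun x => (x ^+ k * v j x)%:E)) /\
  exists2 Z : R, Z != 0 &
    {ae lebesgue_tuple n, forall x, 0 <= PE_density v Z x} /\
    (\int[lebesgue_tuple n]_x (PE_density v Z x)%:E = 1)%E.

Definition zero_ext (f : R -> R) (x : R) : R := if 0 < x then f x else 0.

Definition span_ae (I : finType) (f : I -> R -> R) : set (R -> R) :=
  [set g | exists c : I -> R,
     {ae mu, forall x, 0 < x -> g x = \sum_i c i * f i x}].

(* Indices in 'I_r are shifted by one: n_1 is the component of index 0. *)
Definition step_line r (nn : 'I_r -> nat) : Prop :=
  (forall i j : 'I_r, (i <= j)%N -> (nn j <= nn i)%N) /\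
  (forall i j : 'I_r, i = 0%N :> nat -> j = r.-1 :> nat ->
     (nn i - 1 <= nn j)%N).

Definition MOPE_family r (nn : 'I_r -> nat) (w : 'I_r -> R -> R)
    (p : {j : 'I_r & 'I_(nn j)}) (x : R) : R :=
  x ^+ tagged p * w (tag p) x.

(* PE[v_1, ..., v_n] = MOPE[n; w_1, ..., w_r] *)
Definition is_MOPE n r (w : 'I_r -> R -> R) (v : 'I_n -> R -> R) : Prop :=
  is_PE (fun j => zero_ext (v j)) /\
  exists nn : 'I_r -> nat,
    [/\ step_line nn, (\sum_(j < r) nn j)%N = n
      & span_ae v = span_ae (@MOPE_family r nn w)].

Definition abs_cont (a b : R) (f : R -> R) : Prop :=
  forall e : R, 0 < e -> exists2 d : R, 0 < d &
    forall s : seq (R * R),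
      {in s, forall p, [/\ a <= p.1, p.1 <= p.2 & p.2 <= b]} ->
      pairwise (fun p q => (p.2 <= q.1) || (q.2 <= p.1)) s ->
      \sum_(p <- s) (p.2 - p.1) < d ->
      \sum_(p <- s) `|f p.2 - f p.1| < e.

(* C^(n-2) on R_{>0} with locally absolutely continuous (n-2)-th derivative,
   for n >= 2; no condition for n <= 1. *)
Definition MDT_regular n (omega : R -> R) : Prop :=
  if n is m.+2 then
    [/\ forall k x, (k < m)%N -> 0 < x -> derivable (derive1n k omega) x 1,
        forall x, 0 < x -> {for x, continuous (derive1n m omega)}
      & forall a b, 0 < a -> a <= b -> abs_cont a b (derive1n m omega)]
  else True.

(* The function f |-> x f'(x); [derive1] takes a default value where f is not
   differentiable, which under [MDT_regular] concerns only a null set and the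
   last iterate. *)
Definition xD (f : R -> R) (x : R) : R := x * derive1 f x.

Definition is_MDT n (omega : R -> R) (v : 'I_n -> R -> R) : Prop :=
  MDT_regular n omega /\
  span_ae v = span_ae (fun j : 'I_n => iter j xD omega).

(* PE[v_1, ..., v_n] = PE_MDT[n; om].  As om is an element of an L^1-space it
   is only given up to null sets, so the regularity is that of a
   representative. *)
Definition is_PE_MDT n (om : R -> R[i]) (v : 'I_n -> R -> R) : Prop :=
  is_PE (fun j => zero_ext (v j)) /\
  exists2 omega : R -> R,
    {ae mu, forall x, 0 < x -> om x = (omega x)%:C} & is_MDT omega v.

End Ensembles.

(* Main.v *)
Require Import Defs.
From mathcomp Require Import all_boot all_order all_algebra.
From mathcomp Require Import all_classical all_reals all_analysis.
From mathcomp Require Import measurable_realfun.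
From mathcomp Require Import complex zify ring lra.

(** Fix a large N. For s >= N all the arguments of Gamma factors have positive
real part, and the functional equation Gamma(z + 1) = z Gamma(z) turns the
transform of x^k w_j, which is the transform of w_j at s + k, into
<<
  M[x^k w_j](s) = P_{j,k}(s) M[om](s),    deg P_{j,k} < n,   0 <= k < n_j.
>>
The degree bound is where the step line enters: its indices differ by at most
one, so Gamma(s + b_i + n_i) is a polynomial multiple of Gamma(s + k + b_i),
and even of its product with s + k + b_i when i <= j
([step_line_offset], [gamma_quotient], [mellin_ratio]).

A polynomial ensemble can only be built on linearly independent functions, as
otherwise its determinant vanishes and its density integrates to 0
([is_PE_free]). Hence the n functions x^k w_j are independent; since the Mellin
transform is injective, the n polynomials P_{j,k} are independent too and form
a basis of the polynomials of degree < n. Inverting the matrix of coefficients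
gives combinations F_0, ..., F_{n-1} of the x^k w_j with
M[F_j](s) = (- s)^j M[om](s), spanning the same space
([derivative_type_span]).

It remains to recognize F_j as (x d/dx)^j om. Formally this is integration by
parts, but nothing is known about the regularity of om, so the derivatives are
inverted instead: the operator [tail], f |-> - int_x^oo f(t) dt/t, is a right
inverse of x d/dx and divides the transform by - s ([rmellin_tail]). By
injectivity, the j-th tail of F_{n-1} is F_{n-1-j} a.e., and each tail gains
one order of absolute continuity; the last one is the representative of om
that is sought ([regular_representative]). Conversely a regular representative
of om is determined on the half-line as soon as n >= 2, by continuity
([MDT_regular_ae_eq]), which gives the other implication.

Only transforms at real s >= N are available, so injectivity is proved without
complex analysis. With h(x) = f(x) x^N and L = ln, the integrals of
h e^{tL} vanish for small real t. Differentiating at t = 0 gives that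
all moments of L against h vanish; summing the power series of cos and sin,
in short steps, the Fourier transform vanishes ([pairing_cos_sin]); integrating
it against e^{-t} gives Poisson kernels, whose primitives are arctangents,
which rescaled tend to a sign function ([pairing_sg]). So the primitive of
h is constant and h = 0 a.e. ([rmellin_inj]). *)

Set Implicit Arguments.
Unset Strict Implicit.
Unset Printing Implicit Defensive.

Import Order.TTheory GRing.Theory Num.Theory.
Import numFieldNormedType.Exports.

Local Open Scope classical_set_scope.
Local Open Scope ring_scope.
Local Open Scope complex_scope.

(** * Test functions of the logarithm, from exponentials to signs *)

Section TestFunctions.
Context {R : realType} d (T : measurableType d).
Context (mu : {measure set T -> \bar R}) (E : set T) (mE : measurable E).
Variables h L : T -> R.
Hypothesis mh : measurable_fun E h.
Hypothesis mL : measurable_fun E L.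
Hypothesis hL : mu.-integrable E (EFin \o (fun x => h x * expR `|L x|)).

Definition pairing (phi : R -> R) : R := \int[mu]_(x in E) (h x * phi (L x)).

(** The growth is the one that the weighted integrability of h allows: for such
a test function the pairing converges absolutely. *)
Definition exp_bounded (phi : R -> R) : Prop :=
  measurable_fun setT phi /\ exists C, forall y, `|phi y| <= C * expR `|y|.

Lemma pairing_integrable phi : exp_bounded phi ->
  mu.-integrable E (EFin \o (fun x => h x * phi (L x))).
Proof.
move=> [mphi [C hC]].
apply: (le_integrable mE _ _ (integrableZl mE C hL)).
  apply/measurable_EFinP; apply: measurable_funM => //.
  exact: measurableT_comp.
move=> x Ex /=; rewrite lee_fin !normrM [X in _ <= _ * (_ * X)]ger0_norm ?expR_ge0//.
rewrite mulrCA ler_wpM2l//.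
apply: (le_trans (hC _)); rewrite ler_wpM2r ?expR_ge0// ler_norm//.
Qed.

Lemma pairingD phi psi : exp_bounded phi -> exp_bounded psi ->
  pairing (fun y => phi y + psi y) = pairing phi + pairing psi.
Proof.
move=> iphi ipsi; rewrite /pairing -RintegralD//; try exact: pairing_integrable.
by apply: eq_Rintegral => x _; rewrite mulrDr.
Qed.

Lemma pairingZ a phi : exp_bounded phi ->
  pairing (fun y => a * phi y) = a * pairing phi.
Proof.
move=> iphi; rewrite /pairing -RintegralZl//; last exact: pairing_integrable.
by apply: eq_Rintegral => x _; rewrite mulrCA.
Qed.

(** Differentiation under the integral sign: C |h| e^|L| dominates both the
integrand and its derivative, uniformly in the parameter. *)
Lemma pairing_derive (phi phi' : R -> R -> R) (u v C : R) :
  (forall t, t \in `]u, v[ -> measurable_fun setT (phi t)) ->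
  (forall t y, t \in `]u, v[ -> `|phi t y| <= C * expR `|y|) ->
  (forall t y, t \in `]u, v[ -> is_derive t 1 (phi ^~ y) (phi' t y)) ->
  (forall t y, t \in `]u, v[ -> `|phi' t y| <= C * expR `|y|) ->
  forall t, t \in `]u, v[ ->
    is_derive t 1 (fun t => pairing (phi t)) (pairing (phi' t)).
Proof.
move=> mphi bphi dphi bphi' t tuv.
pose f t x := h x * phi t (L x).
have df s x : s \in `]u, v[ -> is_derive s 1 (f ^~ x) (h x * phi' s (L x)).
  move=> suv; have ? := dphi s (L x) suv.
  apply: is_derive_eq.
  by [].
have hI s : `]u, v[%classic s -> s \in `]u, v[ by [].
have intf s : `]u, v[%classic s -> mu.-integrable E (EFin \o f s).
  by move=> suv; apply: pairing_integrable; split; [exact: mphi|exists C => y; exact: bphi].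
have derf s x : `]u, v[%classic s -> E x -> derivable (f ^~ x) s 1.
  by move=> /hI/df.
have iG : mu.-integrable E (EFin \o (fun x => `|C * (h x * expR `|L x|)|)).
  by apply: integrable_norm => //; exact: (integrableZl mE C hL).
have Gub s x : `]u, v[%classic s -> E x ->
    `|partial1of2 f s x| <= `|C * (h x * expR `|L x|)|.
  move=> /hI suv Ex; rewrite partial1of2E.
  have -> := @derive_val _ _ _ _ _ _ _ (df s x suv).
  rewrite mulrCA [leRHS]normrM normrM ler_wpM2l//.
  by apply: (le_trans (bphi' _ _ suv)); exact: ler_norm.
have pE x : E x -> partial1of2 f t x = h x * phi' t (L x).
  move=> Ex; rewrite partial1of2E.
  by have -> := @derive_val _ _ _ _ _ _ _ (df t x tuv).
apply: DeriveDef.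
  exact: (derivable_under_integral mE tuv intf derf (fun=> normr_ge0 _) iG Gub).
rewrite -derive1E.
rewrite (differentiation_under_integral mE tuv intf derf (fun=> normr_ge0 _) iG Gub).
by apply: eq_Rintegral => x; rewrite inE => Ex; exact: pE.
Qed.

(** The way in which vanishing is passed from one family of test functions to
its primitives: only the derivative has to be paired with h. *)
Lemma pairing_cst (phi phi' : R -> R -> R) (u v C : R) :
  (forall t, t \in `]u, v[ -> measurable_fun setT (phi t)) ->
  (forall t y, t \in `]u, v[ -> `|phi t y| <= C * expR `|y|) ->
  (forall t y, t \in `]u, v[ -> is_derive t 1 (phi ^~ y) (phi' t y)) ->
  (forall t y, t \in `]u, v[ -> `|phi' t y| <= C * expR `|y|) ->
  (forall t, t \in `]u, v[ -> pairing (phi' t) = 0) ->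
  {in `]u, v[ &, forall s t, pairing (phi s) = pairing (phi t)}.
Proof.
move=> mphi bphi dphi bphi' z.
have key s t : s \in `]u, v[ -> t \in `]u, v[ -> s < t ->
    pairing (phi s) = pairing (phi t).
  move=> suv tuv st.
  have sub x : x \in `[s, t] -> x \in `]u, v[.
    move: suv tuv; rewrite !in_itv/= => /andP[us sv] /andP[ut tv] /andP[sx xt].
    by rewrite (lt_le_trans us sx) (le_lt_trans xt tv).
  have dI x : x \in `[s, t] ->
      is_derive x 1 (fun t => pairing (phi t)) (pairing (phi' x)).
    by move=> /sub xuv; exact: (pairing_derive mphi bphi dphi bphi' xuv).
  pose F r := pairing (phi r); pose F' r := pairing (phi' r).
  have dF x : x \in `]s, t[ -> is_derive x 1 F (F' x).
    by move=> xst; apply: dI; exact: subset_itv_oo_cc.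
  have cF : {within `[s, t], continuous F}.
    by apply: derivable_within_continuous => x xst; case: (dI x xst).
  have [x xst] := MVT st dF cF.
  rewrite /F' z ?mul0r; last by apply: sub; exact: subset_itv_oo_cc.
  by move/eqP; rewrite subr_eq0 eq_sym => /eqP.
move=> s t suv tuv; have [st|ts|->//] := ltgtP s t; first exact: key.
by apply/esym; exact: key.
Qed.

Lemma pairing_lim (phi_ : nat -> R -> R) (phi : R -> R) C l :
  (forall n, measurable_fun setT (phi_ n)) ->
  (forall n y, `|phi_ n y| <= C * expR `|y|) ->
  (forall y, phi_ n y @[n --> \oo] --> phi y) ->
  (forall n, pairing (phi_ n) = l) -> pairing phi = l.
Proof.
move=> mphi bphi cphi il.
have mf n : measurable_fun E (EFin \o (fun x => h x * phi_ n (L x))).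
  by apply: measurable_int (pairing_integrable _); split; [exact: mphi|exists C].
have cf x : E x ->
    (h x * phi_ n (L x))%:E @[n --> \oo] --> (h x * phi (L x))%:E.
  move=> Ex; apply: cvg_EFin; first exact: nearW.
  by apply: cvgMl_tmp; exact: cphi.
have mlim : measurable_fun E (EFin \o (fun x => h x * phi (L x))).
  by apply: (emeasurable_fun_cvg _ _ mf) => x Ex; exact: cf.
pose G x := `|C * (h x * expR `|L x|)|.
have bf : {ae mu, forall x n, E x -> (`|(h x * phi_ n (L x))%:E| <=
    (EFin \o G) x)%E}.
  apply: aeW => x n Ex; rewrite lee_fin /G mulrCA normrM [leRHS]normrM ler_wpM2l//.
  by apply: (le_trans (bphi _ _)); exact: ler_norm.
have iG : mu.-integrable E (EFin \o G).
  apply: integrable_norm => //; exact: (integrableZl mE C hL).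
have [i_ _ +] := dominated_convergence mE mf mlim (aeW _ cf) iG bf.
move=> cv; rewrite /pairing /Rintegral.
have -> : (\int[mu]_(x in E) (h x * phi (L x))%:E = l%:E)%E; last by [].
rewrite -(cvg_lim _ cv)//; apply: cvg_lim => //.
apply: cvg_near_cst; apply: nearW => n.
rewrite /= -[LHS]fineK; last first.
  apply: (integrable_fin_num mE); apply: pairing_integrable.
  by split; [exact: mphi|exists C].
by congr EFin; exact: il.
Qed.

(** Half of the exponential growth absorbs the power, and the other half is left
for a second factor; compare [mul_le_expR] and [pairing_entire]. *)
Lemma exprn_le_expR (k : nat) (y : R) :
  `|y ^+ k| <= (2 ^+ k * k`!%:R) * expR (`|y| / 2).
Proof.
case: k => [|k].
  by rewrite !expr0 normr1 !mul1r -expR0 ler_expR divr_ge0.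
have y2 : 0 <= `|y| / 2 by rewrite divr_ge0.
have le1 : (`|y| / 2) ^+ k.+1 / (k.+1)`!%:R <= expR (`|y| / 2).
  by apply: le_trans (expR_ge1Dxn k y2); rewrite lerDr.
have -> : `|y ^+ k.+1| = (2 ^+ k.+1 * k.+1`!%:R) * ((`|y| / 2) ^+ k.+1 / (k.+1)`!%:R).
  rewrite normrX expr_div_n; field.
  by rewrite pnatr_eq0 -lt0n fact_gt0 expf_neq0.
by rewrite ler_wpM2l// mulr_ge0// exprn_ge0.
Qed.

Lemma mul_le_expR (k : nat) (t y : R) : t \in `]- 2^-1, 2^-1[ ->
  `|y ^+ k * expR (t * y)| <= (2 ^+ k * k`!%:R) * expR `|y|.
Proof.
rewrite in_itv/= -ltr_norml => t2.
rewrite normrM; apply: (le_trans (ler_wpM2r (normr_ge0 _) (exprn_le_expR k y))).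
rewrite -[leLHS]mulrA ler_wpM2l ?mulr_ge0 ?exprn_ge0//.
rewrite [X in _ * X]ger0_norm ?expR_ge0// -expRD ler_expR.
rewrite [leRHS]splitr lerD2l (le_trans (ler_norm _))// normrM mulrC.
by rewrite ler_wpM2l// ltW.
Qed.

Lemma is_derive_measurable (f g : R -> R) :
  (forall x : R, is_derive x 1 f (g x)) -> measurable_fun setT f.
Proof.
move=> df; apply: continuous_measurable_fun => x.
by apply/differentiable_continuous/derivable1_diffP; case: (df x).
Qed.

(** The two-sided Laplace transform of the image of h under L vanishes near 0. *)
Hypothesis transform0 : forall t : R, t \in `]- 2^-1, 2^-1[ ->
  pairing (fun y => expR (t * y)) = 0.

(** Each derivative in t of the identically zero function t |-> int h e^{tL} is
zero, and at t = 0 it is a moment. *)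
Lemma pairing_exprn k : pairing (fun y => y ^+ k) = 0.
Proof.
have mphi j t : measurable_fun setT (fun y : R => y ^+ j * expR (t * y)).
  apply: measurable_funM; first exact: measurable_funX.
  by apply: measurableT_comp => //; exact: measurable_funM.
suff key j (t : R) : t \in `]- 2^-1, 2^-1[ ->
    pairing (fun y => y ^+ j * expR (t * y)) = 0.
  have <- := key k 0; first by congr pairing; apply/funext => y; rewrite mul0r expR0 mulr1.
  by rewrite in_itv/= oppr_lt0 invr_gt0 ltr0n.
elim: j t => [t t2|j ih t t2].
  by rewrite -[RHS](transform0 t2); congr pairing; apply/funext => y; rewrite mul1r.
pose C := (2 ^+ j * j`!%:R) + (2 ^+ j.+1 * j.+1`!%:R) : R.
have der : is_derive t 1 (fun t => pairing (fun y => y ^+ j * expR (t * y)))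
    (pairing (fun y => y ^+ j.+1 * expR (t * y))).
  apply: (@pairing_derive (fun t y => y ^+ j * expR (t * y))
    (fun t y => y ^+ j.+1 * expR (t * y)) (- 2^-1) (2^-1) C) => //.
  - move=> s y s2; apply: (le_trans (mul_le_expR _ _ s2)).
    by rewrite ler_wpM2r ?expR_ge0// lerDl mulr_ge0// exprn_ge0.
  - move=> s y s2; apply: is_derive_eq.
    by rewrite /GRing.scale/= exprSr; ring.
  - move=> s y s2; apply: (le_trans (mul_le_expR _ _ s2)).
    by rewrite ler_wpM2r ?expR_ge0// lerDr mulr_ge0// exprn_ge0.
have <- := derive_val (is_derive := der).
rewrite (@near_eq_derive _ _ _ _ (cst 0)) ?derive_cst//.
have := near_in_itvoo t2; apply: filterS => s; exact: ih.
Qed.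

Lemma series_bound (c : nat -> R) (y : R) n :
  (forall i, `|c i| <= i`!%:R^-1) ->
  `|series (fun i => c i * y ^+ i) n| <= expR `|y|.
Proof.
move=> hc; have e0 i : 0 <= exp_coeff `|y| i by exact: exp_coeff_ge0.
apply: (@le_trans _ _ (series (exp_coeff `|y|) n)).
  apply: (le_trans (ler_norm_sum _ _ _)); apply: ler_sum => i _.
  by rewrite normrM normrX mulrC /exp_coeff/= ler_wpM2l// exprn_ge0.
apply: nondecreasing_cvgn_le; last exact: is_cvg_series_exp_coeff.
by apply/nondecreasing_seqP => i; rewrite seriesSr lerDl.
Qed.

(** A power series dominated by the exponential series may be integrated term by
term, provided that its argument is scaled by at most 1/2: beyond this the
partial sums are no longer dominated by the growth that h tolerates. *)
Lemma pairing_entire (c : nat -> R) (psi phi : R -> R) (C eta : R) :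
  (forall i, `|c i| <= i`!%:R^-1) ->
  (forall y, series (fun i => c i * y ^+ i) n @[n --> \oo] --> phi y) ->
  measurable_fun setT psi -> (forall y, `|psi y| <= C * expR (`|y| / 2)) ->
  (forall i, pairing (fun y => psi y * y ^+ i) = 0) ->
  `|eta| <= 2^-1 -> pairing (fun y => psi y * phi (eta * y)) = 0.
Proof.
move=> hc cphi mpsi bpsi i0 eta2.
pose s n y := psi y * series (fun i => c i * (eta * y) ^+ i) n.
have C0 : 0 <= C.
  by have := bpsi 0; rewrite normr0 mul0r expR0 mulr1; apply: le_trans.
have term_ok i : exp_bounded (fun y => psi y * y ^+ i).
  split; first by apply: measurable_funM => //; exact: measurable_funX.
  exists (C * (2 ^+ i * i`!%:R)) => y; rewrite normrM.
  apply: (le_trans (ler_pM (normr_ge0 _) (normr_ge0 _) (bpsi y) (exprn_le_expR i y))).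
  rewrite [X in _ <= _ * expR X]splitr expRD le_eqVlt; apply/orP; left; apply/eqP; ring.
have sS n : s n.+1 = fun y => s n y + (c n * eta ^+ n) * (psi y * y ^+ n).
  by apply/funext => y; rewrite /s seriesSr exprMn; ring.
have ms n : measurable_fun setT (s n).
  elim: n => [|n ih]; last first.
    rewrite sS; apply: measurable_funD => //; apply: measurable_funM => //.
    by case: (term_ok n).
  rewrite (_ : s 0 = cst 0); last first.
    by apply/funext => y; rewrite /s /series/= big_nil mulr0.
  exact: measurable_cst.
have bs n y : `|s n y| <= C * expR `|y|.
  rewrite normrM.
  apply: (le_trans (ler_pM (normr_ge0 _) (normr_ge0 _) (bpsi y) (series_bound _ n hc))).
  rewrite -mulrA ler_wpM2l// -expRD ler_expR [leRHS]splitr lerD2l.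
  by rewrite normrM mulrC ler_wpM2l.
apply: (pairing_lim ms bs) => [y|n].
  by apply: cvgMl_tmp; exact: cphi.
elim: n => [|n ih].
  rewrite (_ : s 0 = fun y => 0 * (psi y * y ^+ 0)) ?pairingZ ?mul0r//.
  by apply/funext => y; rewrite /s /series/= big_nil mulr0 mul0r.
rewrite sS pairingD ?ih ?add0r ?pairingZ ?i0 ?mulr0//.
- by split; [exact: ms|exists C].
- case: (term_ok n) => mt [K hK]; split; first exact: measurable_funM.
  exists (`|c n * eta ^+ n| * K) => y; rewrite normrM -mulrA.
  by rewrite ler_wpM2l.
Qed.

Lemma cos_coeff_le i : `|(~~ odd i)%:R * (-1) ^+ i./2 / i`!%:R : R| <= i`!%:R^-1.
Proof.
rewrite !normrM normfV normrX normrN1 expr1n mulr1 !normr_nat.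
by case: odd; rewrite ?mul0r ?mul1r// invr_ge0.
Qed.

Lemma sin_coeff_le i : `|(odd i)%:R * (-1) ^+ i.-1./2 / i`!%:R : R| <= i`!%:R^-1.
Proof.
rewrite !normrM normfV normrX normrN1 expr1n mulr1 !normr_nat.
by case: odd; rewrite ?mul0r ?mul1r// invr_ge0.
Qed.

(** If psi annihilates all moments, then so does psi modulated by a small
frequency: the series of cos and sin are integrated against psi. *)
Lemma pairing_cos_shift (psi : R -> R) (C eta : R) :
  measurable_fun setT psi -> (forall y, `|psi y| <= C * expR (`|y| / 2)) ->
  (forall i, pairing (fun y => psi y * y ^+ i) = 0) ->
  `|eta| <= 2^-1 ->
  pairing (fun y => psi y * cos (eta * y)) = 0 /\
  pairing (fun y => psi y * sin (eta * y)) = 0.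
Proof.
move=> mpsi bpsi i0 eta2; split.
- apply: (pairing_entire cos_coeff_le) mpsi bpsi i0 eta2 => y.
  by rewrite cos.unlock -cos_coeffE; exact: is_cvg_series_cos_coeff.
- apply: (pairing_entire sin_coeff_le) mpsi bpsi i0 eta2 => y.
  by rewrite sin.unlock -sin_coeffE; exact: is_cvg_series_sin_coeff.
Qed.

Lemma measurable_cosM (a : R) : measurable_fun setT (fun y : R => cos (a * y)).
Proof.
apply: measurableT_comp; last exact: measurable_funM.
by apply: continuous_measurable_fun; exact: continuous_cos.
Qed.

Lemma measurable_sinM (a : R) : measurable_fun setT (fun y : R => sin (a * y)).
Proof.
apply: measurableT_comp; last exact: measurable_funM.
by apply: continuous_measurable_fun; exact: continuous_sin.
Qed.

(** The Fourier transform vanishes. The power series reaches frequencies up to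
1/2 only, so a frequency xi is written as n eta with |eta| <= 1/2 and the
addition formulas carry the vanishing from (n eta) to (n + 1) eta; the induction
needs all the products with powers of y. *)
Lemma pairing_cos_sin (xi : R) :
  pairing (fun y => cos (xi * y)) = 0 /\ pairing (fun y => sin (xi * y)) = 0.
Proof.
suff key n (eta : R) : `|eta| <= 2^-1 -> forall k,
    pairing (fun y => y ^+ k * cos ((n%:R * eta) * y)) = 0 /\
    pairing (fun y => y ^+ k * sin ((n%:R * eta) * y)) = 0.
  (* the number of steps makes the step xi / n at most 1/2 *)
  pose n := Num.bound (2 * `|xi|).
  have n0 : 0 < n%:R :> R by apply: le_lt_trans (archi_boundP _); rewrite ?mulr_ge0.
  have eta2 : `|xi / n%:R| <= 2^-1.
    rewrite normrM normfV [X in _ / X]gtr0_norm// ler_pdivrMr//.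
    rewrite -ler_pdivrMl ?invr_gt0// invrK.
    by rewrite ltW// archi_boundP// mulr_ge0.
  have := key n _ eta2 0; rewrite mulrC divfK ?gt_eqF// => -[c0 s0].
  by split; [rewrite -c0|rewrite -s0]; congr pairing; apply/funext => y; rewrite mul1r.
move=> eta2; elim: n => [|n ih] k.
  split.
    rewrite -[RHS](pairing_exprn k); congr pairing; apply/funext => y.
    by rewrite !mul0r cos0 mulr1.
  rewrite -[RHS](mul0r (pairing (fun y => y ^+ k))) -pairingZ; last first.
    split; first exact: measurable_funX.
    exists (2 ^+ k * k`!%:R) => y; apply: (le_trans (exprn_le_expR k y)).
    by rewrite ler_wpM2l ?mulr_ge0 ?exprn_ge0// ler_expR ler_pdivrMr// ler_peMr// ler1n.
  by congr pairing; apply/funext => y; rewrite !mul0r sin0 mulr0.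
pose pc y : R := y ^+ k * cos ((n%:R * eta) * y).
pose ps y : R := y ^+ k * sin ((n%:R * eta) * y).
have mpc : measurable_fun setT pc.
  by apply: measurable_funM; [exact: measurable_funX|exact: measurable_cosM].
have mps : measurable_fun setT ps.
  by apply: measurable_funM; [exact: measurable_funX|exact: measurable_sinM].
have bpc y : `|pc y| <= (2 ^+ k * k`!%:R) * expR (`|y| / 2).
  rewrite normrM; apply: le_trans (exprn_le_expR k y).
  by rewrite ler_piMr// cos_max.
have bps y : `|ps y| <= (2 ^+ k * k`!%:R) * expR (`|y| / 2).
  rewrite normrM; apply: le_trans (exprn_le_expR k y).
  by rewrite ler_piMr// sin_max.
have ipc i : pairing (fun y => pc y * y ^+ i) = 0.
  have [<- _] := ih (k + i)%N; congr pairing; apply/funext => y.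
  by rewrite /pc exprD; ring.
have ips i : pairing (fun y => ps y * y ^+ i) = 0.
  have [_ <-] := ih (k + i)%N; congr pairing; apply/funext => y.
  by rewrite /ps exprD; ring.
have [cc cs] := pairing_cos_shift mpc bpc ipc eta2.
have [sc ss] := pairing_cos_shift mps bps ips eta2.
have tb (f g : R -> R) : measurable_fun setT f -> measurable_fun setT g ->
    (forall y, `|f y| <= (2 ^+ k * k`!%:R) * expR (`|y| / 2)) ->
    (forall y, `|g y| <= 1) -> exp_bounded (fun y => f y * g y).
  move=> mf mg bf bg; split; first exact: measurable_funM.
  exists (2 ^+ k * k`!%:R) => y; rewrite normrM.
  apply: (le_trans (ler_pM (normr_ge0 _) (normr_ge0 _) (bf y) (bg y))).
  by rewrite mulr1 ler_wpM2l ?mulr_ge0 ?exprn_ge0// ler_expR ler_pdivrMr// ler_peMr// ler1n.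
have tN (f : R -> R) : exp_bounded f -> exp_bounded (fun y => -1 * f y).
  move=> [mf [K bf]]; split; first exact: measurable_funM.
  by exists K => y; rewrite normrM normrN1 mul1r.
have e1 : exp_bounded (fun y => pc y * cos (eta * y)).
  by apply: tb => // [|y]; [exact: measurable_cosM|exact: cos_max].
have e2 : exp_bounded (fun y => pc y * sin (eta * y)).
  by apply: tb => // [|y]; [exact: measurable_sinM|exact: sin_max].
have e3 : exp_bounded (fun y => ps y * cos (eta * y)).
  by apply: tb => // [|y]; [exact: measurable_cosM|exact: cos_max].
have e4 : exp_bounded (fun y => ps y * sin (eta * y)).
  by apply: tb => // [|y]; [exact: measurable_sinM|exact: sin_max].
have nE (y : R) : n.+1%:R * eta * y = n%:R * eta * y + eta * y.
  by rewrite -natr1; ring.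
split.
- rewrite (_ : (fun y => _) = fun y => pc y * cos (eta * y) + -1 * (ps y * sin (eta * y))).
    by rewrite pairingD ?pairingZ//; [rewrite cc ss mulr0 addr0|exact: tN].
  by apply/funext => y; rewrite nE cosD /pc /ps; ring.
- rewrite (_ : (fun y => _) = fun y => ps y * cos (eta * y) + pc y * sin (eta * y)).
    by rewrite pairingD// sc cs addr0.
  by apply/funext => y; rewrite nE sinD /pc /ps; ring.
Qed.

Lemma pairing_cos_affine (a v : R) : pairing (fun y => cos (a * (y - v))) = 0.
Proof.
have [c0 s0] := pairing_cos_sin a.
have ec : exp_bounded (fun y => cos (a * y)).
  split; first exact: measurable_cosM.
  by exists 1 => y; rewrite mul1r (le_trans (cos_max _))// -expR0 ler_expR.
have es : exp_bounded (fun y => sin (a * y)).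
  split; first exact: measurable_sinM.
  by exists 1 => y; rewrite mul1r (le_trans (sin_max _))// -expR0 ler_expR.
have eZ (f : R -> R) k : exp_bounded f -> exp_bounded (fun y => k * f y).
  move=> [mf [K bf]]; split; first exact: measurable_funM.
  by exists (`|k| * K) => y; rewrite normrM -mulrA ler_wpM2l.
rewrite (_ : (fun y => _) =
    fun y => cos (a * v) * cos (a * y) + sin (a * v) * sin (a * y)).
  by rewrite pairingD ?pairingZ ?c0 ?s0 ?mulr0 ?addr0//; exact: eZ.
by apply/funext => y; rewrite mulrBr cosB; ring.
Qed.

(** The closed form of int_0^A e^{-t} cos(t z) dt, which tends to the Poisson
kernel 1/(1 + z^2) as A tends to infinity. *)
Definition poisson_cut (A z : R) : R :=
  (1 - expR (- A) * (cos (A * z) - z * sin (A * z))) / (1 + z ^+ 2).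

Lemma oneDsqr_gt0 (z : R) : 0 < 1 + z ^+ 2.
Proof. by rewrite ltr_pwDl// sqr_ge0. Qed.

Lemma is_derive_poisson_cut (z A : R) :
  is_derive A 1 (poisson_cut ^~ z) (expR (- A) * cos (A * z)).
Proof.
rewrite /poisson_cut; apply: is_derive_eq.
rewrite /GRing.scale/=.
have := oneDsqr_gt0 z; move/lt0r_neq0 => z0.
by field.
Qed.

(** Negative A are included so that A = 0 is interior to the interval of
parameters to which [pairing_cst] is applied. *)
Lemma poisson_cut_le (A z : R) : -1 <= A ->
  `|poisson_cut A z| <= 1 + 2 * expR 1.
Proof.
move=> A1; have z0 := oneDsqr_gt0 z.
rewrite /poisson_cut normrM normfV [X in _ / X]gtr0_norm// ler_pdivrMr//.
apply: (le_trans (ler_normB _ _)); rewrite normr1 normrM.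
have e1 : `|expR (- A)| <= expR 1 by rewrite ger0_norm ?expR_ge0// ler_expR lerNl.
have b1 : `|cos (A * z) - z * sin (A * z)| <= 1 + `|z|.
  apply: (le_trans (ler_normB _ _)); rewrite normrM lerD ?cos_max//.
  by rewrite ler_piMr// sin_max.
have zb : 1 + `|z| <= 2 * (1 + z ^+ 2).
  rewrite -(real_normK (num_real z)); have := sqr_ge0 (`|z| - 1).
  by have := normr_ge0 z; nra.
apply: (le_trans (lerD (lexx 1) (ler_pM (normr_ge0 _) (normr_ge0 _) e1 b1))).
have e0 := expR_gt0 (1 : R).
have := ler_wpM2l (ltW e0) zb; have := sqr_ge0 z; lra.
Qed.

Lemma measurable_poisson_cut (A : R) : measurable_fun setT (poisson_cut A).
Proof.
apply: measurable_funM; last first.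
  apply: (@is_derive_measurable _ (fun z => - (1 + z ^+ 2) ^- 2 * (2 * z))) => z.
  have ? := lt0r_neq0 (oneDsqr_gt0 z).
  by apply: is_derive_eq; rewrite /GRing.scale/=; ring.
apply: measurable_funB => //; apply: measurable_funM => //.
apply: measurable_funB; first exact: measurable_cosM.
by apply: measurable_funM => //; exact: measurable_sinM.
Qed.

Lemma le_cst_expR (k : R) (y : R) : 0 <= k -> k <= k * expR `|y|.
Proof. by move=> k0; rewrite ler_peMr// -expR0 ler_expR. Qed.

(** The truncated kernel is constant in A after pairing, as its A-derivative is a
damped cosine; it is 0 for A = 0, and A tends to infinity. *)
Lemma pairing_poisson (a v : R) :
  pairing (fun y => (1 + (a * (y - v)) ^+ 2)^-1) = 0.
Proof.
pose phi A y := poisson_cut A (a * (y - v)).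
have mphi A : measurable_fun setT (phi A).
  apply: measurableT_comp; first exact: measurable_poisson_cut.
  by apply: measurable_funM => //; exact: measurable_funB.
pose C := 1 + 2 * expR 1 : R.
have C0 : 0 <= C by rewrite addr_ge0// mulr_ge0// expR_ge0.
have bphi A y : -1 <= A -> `|phi A y| <= C * expR `|y|.
  by move=> A1; apply: (le_trans (poisson_cut_le _ A1)); exact: le_cst_expR.
have z n : pairing (phi n%:R) = 0.
  have p0 : pairing (phi 0) = 0.
    rewrite (_ : phi 0 = fun y => 0 * cst 0 y).
      rewrite pairingZ ?mul0r//; split; first exact: measurable_cst.
      by exists 1 => y; rewrite normr0 mul1r expR_ge0.
    apply/funext => y; rewrite /phi /poisson_cut !mul0r cos0 sin0 oppr0 expR0.
    by rewrite mulr0 subr0 mul1r subrr mul0r.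
  rewrite -p0.
  apply: (@pairing_cst phi (fun A y => expR (- A) * cos (A * (a * (y - v))))
    (-1) n.+1%:R C).
  - by move=> A _; exact: mphi.
  - by move=> A y; rewrite in_itv/= => /andP[/ltW A1 _]; exact: bphi.
  - by move=> A y _; exact: is_derive_poisson_cut.
  - move=> A y; rewrite in_itv/= => /andP[/ltW A1 _].
    rewrite normrM; apply: (@le_trans _ _ (expR 1)).
      rewrite -[leRHS]mulr1; apply: ler_pM => //; last exact: cos_max.
      by rewrite ger0_norm ?expR_ge0// ler_expR lerNl.
    apply: (@le_trans _ _ C); last exact: le_cst_expR.
    by rewrite /C; have := expR_ge0 (1 : R); lra.
  - move=> A _; rewrite (_ : (fun y => _) = fun y => expR (- A) * cos ((A * a) * (y - v))).
      rewrite pairingZ ?pairing_cos_affine ?mulr0//; split.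
        apply: measurableT_comp; last first.
          by apply: measurable_funM => //; exact: measurable_funB.
        by apply: continuous_measurable_fun; exact: continuous_cos.
      exists 1 => y; rewrite (le_trans (cos_max _))//; exact: le_cst_expR.
    by apply/funext => y; rewrite mulrA.
  - by rewrite in_itv/= ltr_nat ltnSn (lt_le_trans _ (ler0n _ _))// ltrN10.
  - by rewrite in_itv/= ltr0n ltrN10.
apply: (@pairing_lim (fun n => phi n%:R) _ C) => //.
- by move=> n y; apply: bphi; rewrite (le_trans _ (ler0n _ _))// lerN10.
- move=> y; rewrite /phi /poisson_cut; set t := a * (y - v).
  rewrite [X in _ --> X](_ : _ = (1 - 0) / (1 + t ^+ 2)); last by rewrite subr0 mul1r.
  have eg : expR (- n%:R) * (1 + `|t|) @[n --> \oo] --> (0 : R).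
    by rewrite -[X in _ --> X](mul0r (1 + `|t|)); apply: cvgMr_tmp; exact: cvgn_expR.
  have tail0 : expR (- n%:R) * (cos (n%:R * t) - t * sin (n%:R * t)) @[n --> \oo] --> (0 : R).
    apply: (@squeeze_cvgr _ _ _ _ (fun n => - (expR (- n%:R) * (1 + `|t|)))
      (fun n => expR (- n%:R) * (1 + `|t|))) => //.
      apply: nearW => n; rewrite -ler_norml normrM ger0_norm ?expR_ge0//.
      rewrite ler_wpM2l ?expR_ge0//.
      apply: (le_trans (ler_normB _ _)); rewrite normrM lerD ?cos_max//.
      by rewrite ler_piMr// sin_max.
    by rewrite -oppr0; exact: cvgN.
  by apply: cvgMr_tmp; exact: cvgB (cvg_cst _) tail0.
Qed.

(** Moving the centre v of the arctangent differentiates it to a Poisson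
kernel. *)
Lemma pairing_atan (n : nat) (u v : R) :
  pairing (fun y => atan (n%:R * (u - y))) = pairing (fun y => atan (n%:R * (v - y))).
Proof.
pose phi (v y : R) := atan (n%:R * (v - y)).
pose phi' (v y : R) := n%:R * (1 + (n%:R * (y - v)) ^+ 2)^-1.
pose B := 1 + `|u| + `|v|.
pose C := pi / 2 + n%:R : R.
have C0 : 0 <= C by rewrite addr_ge0// divr_ge0// pi_ge0.
apply: (@pairing_cst phi phi' (- B) B C).
- move=> t _; apply: (@is_derive_measurable _
    (fun y => - (n%:R * (1 + (n%:R * (t - y)) ^+ 2)^-1))) => y.
  by rewrite /phi; apply: is_derive_eq; rewrite /GRing.scale/=; ring.
- move=> t y _; apply: (@le_trans _ _ C); last exact: le_cst_expR.
  apply: (@le_trans _ _ (pi / 2)); last by rewrite lerDl.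
  by rewrite ler_norml !ltW ?atan_ltpi2 ?atan_gtNpi2.
- move=> t y _; rewrite /phi; apply: is_derive_eq.
  rewrite /phi' /GRing.scale/= subr0 mulr1 -[t - y]opprB mulrN sqrrN; ring.
- move=> t y _; apply: (@le_trans _ _ C); last exact: le_cst_expR.
  rewrite /phi' normrM normr_nat normfV [X in X^-1]gtr0_norm ?oneDsqr_gt0//.
  apply: (@le_trans _ _ n%:R); last by rewrite lerDr divr_ge0// pi_ge0.
  by rewrite ler_piMr// invf_le1 ?oneDsqr_gt0// lerDl sqr_ge0.
- move=> t _; rewrite pairingZ ?pairing_poisson ?mulr0//; split.
    apply: (@is_derive_measurable _ (fun y =>
      - (1 + (n%:R * (y - t)) ^+ 2) ^- 2 * (2 * (n%:R * (y - t)) * n%:R))) => y.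
    have ? := lt0r_neq0 (oneDsqr_gt0 (n%:R * (y - t))).
    by apply: is_derive_eq; rewrite /GRing.scale/=; ring.
  exists 1 => y; apply: (@le_trans _ _ 1); last exact: le_cst_expR.
  by rewrite normfV gtr0_norm ?oneDsqr_gt0// invf_le1 ?oneDsqr_gt0// lerDl sqr_ge0.
- rewrite in_itv/= -ltr_norml /B; have := normr_ge0 v; lra.
- rewrite in_itv/= -ltr_norml /B; have := normr_ge0 u; lra.
Qed.

Lemma cvg_atan_sg (z : R) :
  atan (n%:R * z) @[n --> \oo] --> (pi / 2) * Num.sg z.
Proof.
have pos (t : R) : 0 < t -> atan (n%:R * t) @[n --> \oo] --> pi / 2.
  move=> t0; have tn : (n%:R * t) @[n --> \oo] --> +oo.
    apply/cvgryPge => A.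
    have /cvgryPge/(_ (A / t)) := @cvgr_idn R.
    by apply: filterS => n; rewrite ler_pdivrMr.
  exact: (cvg_comp _ _ tn (@cvgy_atan R)).
have [z0|z0|->] := ltrgt0P z.
- by rewrite gtr0_sg// mulr1; exact: pos.
- rewrite ltr0_sg// mulrN1 (_ : (fun n => _) = fun n => - atan (n%:R * (- z))).
    by apply: cvgN; apply: pos; rewrite oppr_gt0.
  by apply/funext => n; rewrite mulrN atanN opprK.
- rewrite sgr0 mulr0 (_ : (fun n => _) = cst 0); first exact: cvg_cst.
  by apply/funext => n; rewrite mulr0 atan0.
Qed.

Lemma measurable_sg (v : R) : measurable_fun setT (fun y : R => Num.sg (v - y)).
Proof.
apply: nonincreasing_measurable => // x y xy.
by case: (sgrP (v - x)) => ?; case: (sgrP (v - y)) => ?; lra.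
Qed.

(** The limit of the rescaled arctangents. As the difference of two such signs is,
up to end points, twice the indicator of an interval, h integrates to 0 over the
preimages of intervals under L. *)
Lemma pairing_sg (u v : R) :
  pairing (fun y => Num.sg (u - y)) = pairing (fun y => Num.sg (v - y)).
Proof.
have es w : exp_bounded (fun y => Num.sg (w - y)).
  split; first exact: measurable_sg.
  by exists 1 => y; apply: le_trans (le_cst_expR _ _); rewrite // normr_sg lern1 leq_b1.
have ea n w : exp_bounded (fun y => atan (n%:R * (w - y))).
  split; last first.
    exists (pi / 2) => y; apply: le_trans (le_cst_expR _ _).
      by rewrite ler_norml !ltW ?atan_ltpi2 ?atan_gtNpi2.
    by rewrite divr_ge0// pi_ge0.
  apply: (@is_derive_measurable _ (fun y => - (n%:R * (1 + (n%:R * (w - y)) ^+ 2)^-1))) => y.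
  by apply: is_derive_eq; rewrite /GRing.scale/=; ring.
have eZ (f : R -> R) k : exp_bounded f -> exp_bounded (fun y => k * f y).
  move=> [mf [K bf]]; split; first exact: measurable_funM.
  by exists (`|k| * K) => y; rewrite normrM -mulrA ler_wpM2l.
have : pairing (fun y => (pi / 2) * Num.sg (u - y) + -1 * ((pi / 2) * Num.sg (v - y))) = 0.
  apply: (@pairing_lim (fun n y => atan (n%:R * (u - y)) + -1 * atan (n%:R * (v - y))) _ pi).
  - move=> n; have [? _] := ea n u; have [? _] := eZ _ (-1) (ea n v).
    exact: measurable_funD.
  - move=> n y; apply: (@le_trans _ _ pi); last by apply: le_cst_expR; exact: pi_ge0.
    have := atan_ltpi2 (n%:R * (u - y)); have := atan_gtNpi2 (n%:R * (u - y)).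
    have := atan_ltpi2 (n%:R * (v - y)); have := atan_gtNpi2 (n%:R * (v - y)).
    by rewrite ler_norml; lra.
  - move=> y; apply: cvgD; first exact: cvg_atan_sg.
    by apply: cvgMl_tmp; exact: cvg_atan_sg.
  - move=> n; rewrite pairingD//; last exact: eZ.
    by rewrite pairingZ// (pairing_atan n u v) mulN1r subrr.
rewrite pairingD ?pairingZ//; try exact/eZ/eZ; try exact: eZ.
have p0 : pi / 2 != 0 :> R by rewrite gt_eqF// divr_gt0// pi_gt0.
move=> e; apply: (mulfI p0); lra.
Qed.

End TestFunctions.

(** * Injectivity of the Mellin transform on a half-line *)

Section Injectivity.
Context {R : realType}.
Local Notation mu := (@lebesgue_measure R).
Local Notation D := (`]0, +oo[%classic : set R).

(** Only a half-line s >= N of exponents is kept: it suffices for injectivity, is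
stable under multiplication by x and by [tail], and stays away from poles. *)
Definition mellin_integrable (N : R) (f : R -> R) : Prop :=
  measurable_fun D f /\
  forall s, N <= s -> mu.-integrable D (EFin \o (fun x => f x * x `^ (s - 1))).

Definition rmellin (f : R -> R) (s : R) : R :=
  \int[mu]_(x in D) (f x * x `^ (s - 1)).

Lemma powR_expR (x a : R) : 0 < x -> x `^ a = expR (a * ln x).
Proof. by move=> x0; rewrite /powR gt_eqF. Qed.

Lemma mD : measurable (D : set (measurableTypeR R)). Proof. exact: measurable_itv. Qed.

Lemma in_D (x : R) : D x = (0 < x) :> Prop.
Proof. by rewrite /= in_itv/= andbT. Qed.

(** Centring at s = N + 1 puts the weights x^N x^t with |t| < 1/2, and even
|t| <= 1, in the range of exponents where f is integrable. The pairing with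
sg (ln p - ln x) is 2 F(p) minus a constant, F being the primitive of f x^N; so
F is constant, and its derivative is a.e. the integrand. *)
Lemma rmellin_inj (N : R) (f : R -> R) : mellin_integrable N f ->
  (forall s, N <= s -> rmellin f s = 0) ->
  {ae mu, forall x, 0 < x -> f x = 0}.
Proof.
move=> [mf intf] f0.
pose h x := f x * x `^ N.
have mh : measurable_fun D h.
  by apply: measurable_funM => //; apply: measurable_funTS; exact: measurable_powR.
have mL : measurable_fun D (@ln R).
  by apply: measurable_funTS; exact: measurable_ln.
have hL : mu.-integrable D (EFin \o (fun x => h x * expR `|ln x|)).
  (* e^|ln x| is at most x + 1/x, so the exponents N and N + 2 suffice *)
  have N2 : N <= N + 2 by rewrite lerDl.
  have i1 := integrable_norm (intf _ N2).
  have i2 := integrable_norm (intf _ (lexx N)).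
  have i12 := integrableD mD i1 i2.
  apply: (le_integrable mD _ _ i12).
    apply/measurable_EFinP; apply: measurable_funM => //.
    by apply: measurableT_comp => //; exact: measurableT_comp.
  move=> x; rewrite in_D => x0 /=; rewrite lee_fin.
  have eN a : `|expR a| = expR a :> R by rewrite ger0_norm ?expR_ge0.
  apply: le_trans (ler_norm _); rewrite /h -mulrA.
  rewrite normrM.
  rewrite !(normrM (f x)) -mulrDr ler_wpM2l//.
  rewrite !(powR_expR _ x0) -expRD !eN.
  have [l0|l0] := leP 0 (ln x).
    apply: (@le_trans _ _ (expR ((N + 2 - 1) * ln x))); last by rewrite lerDl expR_ge0.
    by rewrite ler_expR (ger0_norm l0); lra.
  apply: (@le_trans _ _ (expR ((N - 1) * ln x))); last by rewrite lerDr expR_ge0.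
  by rewrite ler_expR (ltr0_norm l0); lra.
have tr t : t \in `]- 2^-1, 2^-1[ -> pairing mu D h (@ln R) (fun y => expR (t * y)) = 0.
  rewrite in_itv/= => /andP[t1 _].
  have Nt : N <= N + 1 + t by lra.
  rewrite -[RHS](f0 _ Nt) /pairing /rmellin; apply: eq_Rintegral => x; rewrite inE in_D => x0.
  by rewrite /h -mulrA !(powR_expR _ x0) -expRD; congr (_ * expR _); ring.
have sgc := pairing_sg mD mh mL hL tr.
have ih : mu.-integrable D (EFin \o h).
  have N1 : N <= N + 1 by rewrite lerDl.
  by have := intf _ N1; rewrite addrK.
pose H := h \_ D.
have iH : mu.-integrable setT (EFin \o H).
  by rewrite -restrict_EFin; exact/(integrable_mkcond _ mD).1.
pose F x := \int[mu]_(t in `]0, x]) H t.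
have sgF p : 0 < p -> pairing mu D h (@ln R) (fun y => Num.sg (ln p - y)) =
    2 * F p - \int[mu]_(x in D) h x.
  move=> p0.
  have FE : F p = \int[mu]_(x in D) (h \_ `]0, p]) x.
    rewrite -Rintegral_mkcondr /F.
    have -> : D `&` `]0, p] = `]0, p]%classic.
      by apply/seteqP; split => x /=; rewrite !in_itv/= ?andbT; [case|case/andP=> ->].
    apply: eq_Rintegral => x; rewrite inE/= in_itv/= => /andP[x0 _].
    by rewrite /H patchE mem_set// in_D.
  have iP : mu.-integrable D (EFin \o (h \_ `]0, p])).
    rewrite -restrict_EFin; apply/integrable_restrict => //.
    by apply: (integrableS mD) => //; apply: measurableI.
  rewrite FE -RintegralZl//.
  rewrite -RintegralB//; last first.
    by have := integrableZl mD 2 iP.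
  rewrite /pairing /Rintegral; congr fine; apply: ae_eq_integral => //.
  - apply/measurable_EFinP; apply: measurable_funM => //.
    exact: (measurableT_comp (measurable_sg (ln p)) mL).
  - apply/measurable_EFinP; apply: measurable_funB => //.
    by apply: measurable_funM => //; apply/measurable_EFinP; exact: measurable_int iP.
  - exists [set p]; split => //; first exact: lebesgue_measure_set1.
    move=> x /=; apply: contra_notP => /eqP xp; rewrite in_itv/= andbT => x0.
    congr EFin; rewrite patchE.
    have [xp'|px] := ltP x p.
      by rewrite mem_set/= ?in_itv/= ?x0 ?ltW// gtr0_sg ?subr_gt0 ?ltr_ln//; ring.
    rewrite memNset/=; last by rewrite in_itv/= x0/=; apply/negP;
      rewrite -ltNge lt_neqAle eq_sym xp.
    have l0 : ln p - ln x < 0.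
      by rewrite subr_lt0 ltr_ln ?posrE// lt_neqAle px eq_sym xp.
    by rewrite (ltr0_sg l0) (_ : point = 0)//; ring.
have Fcst p q : 0 < p -> 0 < q -> F p = F q.
  by move=> p0 q0; have := sgc (ln p) (ln q); rewrite !sgF//; lra.
have lH : locally_integrable setT H by exact: integrable_locally ih.
have iHy y : mu.-integrable `]0, y] (EFin \o H) by apply: integrableS iH.
have := FTC1 iHy lH.
apply: filterS; first exact: (ae_filter_ringOfSetsType mu).
move=> x dF x0; have [|_] := dF; first by [].
rewrite derive1E (@near_eq_derive _ _ _ _ (cst (F x))) ?derive_cst.
  rewrite /H patchE mem_set ?in_D// => /esym/eqP.
  by rewrite mulf_eq0 (gt_eqF (powR_gt0 _ x0)) orbF => /eqP.
near=> y; apply: Fcst => //; near: y; exact: lt_nbhsr.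
Unshelve. all: by end_near. Qed.

End Injectivity.

(** * The inverse of x d/dx *)

Section Tail.
Context {R : realType}.
Local Notation mu := (@lebesgue_measure R).
Local Notation D := (`]0, +oo[%classic : set R).

Lemma integral_powR (s t : R) : 1 < s -> 0 < t ->
  (\int[mu]_x (((0 < x) && (x < t))%R%:R * x `^ (s - 1))%:E = (t `^ s / s)%:E)%E.
Proof.
move=> s1 t0; have s0 : 0 < s by exact: lt_trans s1.
have cvg0 (a : R) : 0 < a -> x `^ a @[x --> 0^'+] --> (0 : R) `^ a.
  by move=> a0; rewrite powR0 ?gt_eqF//; exact: powR_cvg0.
have dx (a x : R) : 0 < x -> derivable (fun x : R => x `^ a) x 1.
  by move=> x0; apply: derivable_powR; rewrite in_itv/= x0.
have cx (a x : R) : 0 < x -> {for x, continuous (fun x : R => x `^ a)}.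
  by move=> x0; apply/differentiable_continuous/derivable1_diffP; exact: dx.
transitivity (\int[mu]_(x in `]0%R, t[) (x `^ (s - 1))%:E)%E.
  rewrite [RHS]integral_mkcond; apply: eq_integral => x _.
  rewrite patchE; case: ifPn; rewrite ?inE ?notin_setE/= in_itv/= => h.
    by rewrite h mul1r.
  by move/negP/negbTE : h => ->; rewrite mul0r.
have mp A : measurable_fun A (fun x : R => (x `^ (s - 1))%:E).
  by apply/measurable_EFinP; apply: measurable_funTS; exact: measurable_powR.
rewrite integral_itv_bndo_bndc; last exact (mp _).
rewrite integral_itv_obnd_cbnd//.
rewrite (@continuous_FTC2 _ _ (fun x : R => x `^ s / s))//.
- by rewrite powR0 ?gt_eqF// mul0r sube0.
- apply/continuous_within_itvP => //; split.
  + by move=> x; rewrite in_itv/= => /andP[x0 _]; exact: cx.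
  + by apply: cvg0; rewrite subr_gt0.
  + by apply: cvg_at_left_filter; exact: cx.
- split.
  + move=> x; rewrite in_itv/= => /andP[x0 _].
    by apply: derivableM => //; exact: dx.
  + by apply: cvgMr_tmp; exact: cvg0.
  + by apply: cvgMr_tmp; apply: cvg_at_left_filter; exact: cx.
- move=> x; rewrite in_itv/= => /andP[x0 _]; rewrite derive1E.
  have ? := is_derive1_powR s x0.
  have -> := @derive_val _ _ _ _ _ (fun x : R => x `^ s / s) _ _.
  by rewrite /GRing.scale/=; field; rewrite gt_eqF.
Qed.

(** Solves x g' = f with g(oo) = 0. *)
Definition tail (f : R -> R) (x : R) : R := - \int[mu]_(t in `]x, +oo[) (f t / t).

Variables (N : R) (f : R -> R).
Hypothesis N1 : 1 < N.
Hypothesis mf : mellin_integrable N f.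

Lemma integrable_divx (x : R) : 0 < x ->
  mu.-integrable `]x, +oo[ (EFin \o (fun t => f t / t)).
Proof.
move=> x0; have [mf0 intf] := mf.
have sub : `]x, +oo[%classic `<=` D.
  by move=> t; rewrite in_D /= in_itv/= andbT; exact: lt_trans.
have mx : measurable (`]x, +oo[%classic : set (measurableTypeR R)) by exact: measurable_itv.
have i1 := integrableS mD mx sub (intf N (lexx N)).
have i2 := integrableZl mx (x `^ (- N)) i1.
apply: (le_integrable mx _ _ i2).
  apply/measurable_EFinP; apply: measurable_funM; first exact: measurable_funS mf0.
  apply: (@eq_measurable_fun _ _ _ _ _ (fun t : R => t `^ (- 1))).
    move=> t; rewrite inE/= in_itv/= andbT => xt.
    by rewrite powR_inv1// ltW// (lt_trans x0).
  by apply: measurable_funTS; exact: measurable_powR.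
move=> t; rewrite /= in_itv/= andbT => xt; have t0 := lt_trans x0 xt.
rewrite lee_fin mulrCA !normrM ler_wpM2l//.
rewrite -normrM !gtr0_norm ?mulr_gt0 ?powR_gt0 ?invr_gt0//.
rewrite !powR_expR// -expRD -[t in leLHS]lnK ?posrE// -expRN ler_expR.
have lxt : ln x <= ln t by rewrite ler_ln ?posrE// ltW.
have N0 : 0 <= N by rewrite ltW// (lt_trans _ N1).
have := mulr_ge0 N0 (_ : 0 <= ln t - ln x); rewrite subr_ge0 => /(_ lxt); lra.
Qed.

Lemma tailB (x y : R) : 0 < x -> x <= y ->
  tail f y - tail f x = \int[mu]_(t in `]x, y]) (f t / t).
Proof.
move=> x0 xy.
have yoo : (BRight y <= +oo%O)%O by [].
have xy' : (BRight x <= BRight y)%O by rewrite bnd_simp.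
have := Rintegral_itvB (integrable_divx x0) xy' yoo.
rewrite /tail => <-; ring.
Qed.

(** The integrand of the double integral obtained by inserting the definition of
[tail] into the Mellin transform. The factor 1/t is the real power t^(-1), whose
measurability is immediate, and the domain 0 < x < t is a product of two
indicators. *)
Let kernel (g : R -> R) (s : R) (z : R * R) : R :=
  g z.2 * z.2 `^ (- 1) *
    (((0 < z.1)%R%:R * (z.1 < z.2)%R%:R) * z.1 `^ (s - 1)).

Let kernelE g s z : kernel (g \_ D) s z =
  (g \_ D) z.2 * z.2 `^ (- 1) *
    (((0 < z.1) && (z.1 < z.2))%R%:R * z.1 `^ (s - 1)).
Proof. by rewrite /kernel -natrM mulnb. Qed.

Let integral_kernel (g : R -> R) (s t : R) : 1 < s ->
  (\int[mu]_x (kernel (g \_ D) s (x, t))%:E =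
   (((fun t => (g t * t `^ (s - 1)) / s) \_ D) t)%:E)%E.
Proof.
move=> s1; have s0 : 0 < s by exact: lt_trans s1.
under eq_integral do rewrite kernelE.
rewrite patchE; have [|tD] := boolP (t \in D); last first.
  have gt : (g \_ D) t = 0 by rewrite patchE (negbTE tD).
  by under eq_integral do rewrite /= gt !mul0r; rewrite integral0.
rewrite inE in_D => t0 /=.
have -> : (g \_ D) t = g t by rewrite patchE mem_set// in_D.
have int : mu.-integrable setT
    (EFin \o (fun x => ((0 < x) && (x < t))%R%:R * x `^ (s - 1))).
  apply/integrableP; split.
    apply/measurable_EFinP; apply: measurable_funM; last exact: measurable_powR.
    rewrite (_ : (fun x => _) = \1_`]0, t[).
      by apply: measurable_indic; exact: measurable_itv.
    by apply/funext => x; rewrite indicE mem_setE in_itv.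
  under eq_integral => x _ do rewrite /= ger0_norm ?mulr_ge0 ?powR_ge0//.
  by rewrite integral_powR// ltry.
under eq_integral do rewrite EFinM.
rewrite integralZl// integral_powR// -EFinM; congr EFin.
have ts : t `^ s = t * t `^ (s - 1).
  have e : 1 + (s - 1) = s by ring.
  have tD : t `^ (1 + (s - 1)) = t `^ 1 * t `^ (s - 1).
    by rewrite [LHS]powRD// (gt_eqF t0) implybT.
  by move: tD; rewrite e powRr1// ltW.
by rewrite powR_inv1 ?ltW// ts; field; rewrite !gt_eqF.
Qed.

Let measurable_kernel (g : R -> R) (s : R) : measurable_fun D g ->
  measurable_fun setT (kernel (g \_ D) s).
Proof.
move=> mg.
have mb (b : R * R -> bool) : measurable_fun setT b ->
    measurable_fun setT (fun z => ((b z)%:R : R)).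
  by move=> mb; apply: (measurableT_comp (f := fun b : bool => b%:R : R)).
have mgD := iffLR (measurable_restrictT g mD) mg.
apply: measurable_funM.
  apply: measurable_funM.
    exact: (measurableT_comp mgD measurable_snd).
  exact: (measurableT_comp (measurable_powR (- 1)) measurable_snd).
apply: measurable_funM; last first.
  exact: (measurableT_comp (measurable_powR (s - 1)) measurable_fst).
by apply: measurable_funM; apply: mb; apply: measurable_fun_ltr.
Qed.

Let kernel_integrable (s : R) : N <= s ->
  (mu \x mu)%E.-integrable setT (EFin \o kernel (f \_ D) s).
Proof.
move=> Ns; have s1 := lt_le_trans N1 Ns.
have s0 : 0 < s by exact: lt_trans s1.
have [mf0 intf] := mf.
apply/integrable21ltyP.
  by apply/measurable_EFinP; exact: measurable_kernel.
have -> : (\int[mu]_y \int[mu]_x `|(EFin \o kernel (f \_ D) s) (x, y)| =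
    \int[mu]_(t in D) (`|f t * t `^ (s - 1)| / s)%:E)%E.
  rewrite [RHS]integral_mkcond; apply: eq_integral => t _.
  rewrite [in RHS]restrict_EFin /=.
  have -> : ((fun t => `|f t * t `^ (s - 1)| / s) \_ D) t =
      ((fun t => ((fun t => `|f t|) t * t `^ (s - 1)) / s) \_ D) t.
    by rewrite !patchE; case: ifP => // _; rewrite normrM (ger0_norm (powR_ge0 _ _)).
  rewrite -integral_kernel//; apply: eq_integral => x _ /=.
  rewrite /kernel /= !normrM !patchE.
  rewrite !(ger0_norm (powR_ge0 _ _)) !normr_nat.
  by case: ifP => // _; rewrite (_ : point = 0)// normr0.
have := integrableZl mD s^-1 (integrable_norm (intf s Ns)).
move=> /integrableP[_]; apply: le_lt_trans; rewrite le_eqVlt; apply/orP; left.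
apply/eqP; apply: eq_integral => t _ /=.
by rewrite [in RHS]ger0_norm ?mulr_ge0 ?invr_ge0 ?(ltW s0)// mulrC.
Qed.

Let kernel_tail (s x : R) : 0 < x ->
  (\int[mu]_t (kernel (f \_ D) s (x, t))%:E = (- (tail f x * x `^ (s - 1)))%:E)%E.
Proof.
move=> x0; rewrite /tail mulNr opprK -RintegralZr//; last exact: integrable_divx.
rewrite /Rintegral fineK; last first.
  apply: integrable_fin_num => //.
  have mx : measurable (`]x, +oo[%classic : set (measurableTypeR R)) by exact: measurable_itv.
  by have := integrableZr mx (x `^ (s - 1)) (integrable_divx x0).
rewrite [RHS]integral_mkcond; apply: eq_integral => t _.
rewrite kernelE /= !patchE x0/= !mem_setE !in_itv/= !andbT.
have [xt|xt] := ltP x t; last by rewrite mul0r mulr0.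
by rewrite (lt_trans x0 xt) powR_inv1 ?(ltW (lt_trans x0 xt))// mul1r.
Qed.

(** The inner integral int_0^t x^(s-1) dx = t^s/s converges as s > 0, so the kernel
is integrable on the plane and Tonelli applies. *)
Lemma tail_mellin_integrable : mellin_integrable N (tail f).
Proof.
have int s : N <= s -> mu.-integrable D (EFin \o (fun x => tail f x * x `^ (s - 1))).
  move=> Ns; have iF := integrable_fubini_F (kernel_integrable Ns).
  have iFD := integrableN (integrableS measurableT mD (@subsetT _ _) iF).
  apply: eq_integrable iFD => //= x; rewrite inE in_D => x0.
  by rewrite /fubini_F /= kernel_tail//= opprK.
split=> //.
have /integrableP[/measurable_EFinP mt _] := int N (lexx _).
apply: (@eq_measurable_fun _ _ _ _ _
  (fun x : R => (tail f x * x `^ (N - 1)) * x `^ (1 - N))).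
  move=> x; rewrite inE in_D => x0; rewrite -mulrA -powRD; last by rewrite (gt_eqF x0) implybT.
  by rewrite (_ : N - 1 + (1 - N) = 0) ?powRr0 ?mulr1//; ring.
apply: measurable_funM => //; apply: measurable_funTS; exact: measurable_powR.
Qed.

(** Fubini: integrating the kernel in t first gives - [tail] f, in x first gives
f t^(s-1) / s. *)
Lemma rmellin_tail (s : R) : N <= s -> rmellin (tail f) s = - (rmellin f s / s).
Proof.
move=> Ns; have s1 := lt_le_trans N1 Ns.
have s0 : 0 < s by exact: lt_trans s1.
have [_ intf] := mf; have [_ intt] := tail_mellin_integrable.
have iK := kernel_integrable Ns.
have F12 := Fubini iK.
have e1 : \int[mu]_(x in D) (-1 * (tail f x * x `^ (s - 1))) = - rmellin (tail f) s.
  have := RintegralZl (-1) mD (intt s Ns); rewrite /rmellin mulN1r; apply.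
have e2 : \int[mu]_(x in D) (f x * x `^ (s - 1) / s) = rmellin f s / s.
  by have := RintegralZr s^-1 mD (intf s Ns); apply.
rewrite -e2 -[LHS]opprK -e1; congr (- fine _).
rewrite [LHS]integral_mkcond [RHS]integral_mkcond.
transitivity (\int[mu]_x \int[mu]_t (kernel (f \_ D) s (x, t))%:E)%E.
  apply: eq_integral => x _; rewrite patchE; case: ifPn.
    rewrite inE in_D => x0; apply: etrans (esym (kernel_tail s x0)).
    by congr EFin; exact: mulN1r.
  rewrite notin_setE in_D => /negP/negbTE x0.
  under eq_integral => t _ do rewrite kernelE /= x0 /= mul0r mulr0.
  by rewrite integral0.
rewrite F12; apply: eq_integral => t _.
rewrite restrict_EFin; exact: (integral_kernel f t s1).
Qed.

End Tail.

(** * Local absolute continuity of a function and its derivatives *)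

Section AbsCont.
Context {R : realType}.
Implicit Types (F G H : R -> R) (a b : R).

(** One comparison that covers sums and quotients by x: two dominating functions
are enough for the product rule. *)
Lemma abs_cont_dom K a b F G H : 0 <= K ->
  (forall x y, a <= x -> x <= y -> y <= b ->
    `|F y - F x| <= K * (`|G y - G x| + `|H y - H x|)) ->
  abs_cont a b G -> abs_cont a b H -> abs_cont a b F.
Proof.
move=> K0 dom acG acH e e0.
have e'0 : 0 < e / (2 * (K + 1)) by rewrite divr_gt0// mulr_gt0// ltr_wpDl.
have [d d0 hG] := acG _ e'0; have [d' d'0 hH] := acH _ e'0.
exists (Num.min d d'); first by rewrite lt_min d0.
move=> s sab pw; rewrite lt_min => /andP[sd sd'].
have sG := hG s sab pw sd; have sH := hH s sab pw sd'.
apply: (@le_lt_trans _ _ (K * (\sum_(p <- s) `|G p.2 - G p.1| +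
    \sum_(p <- s) `|H p.2 - H p.1|))).
  rewrite -big_split mulr_sumr big_seq [leRHS]big_seq; apply: ler_sum => p ps.
  by have [ap pp pb] := sab p ps; exact: dom.
apply: (@le_lt_trans _ _ ((K * e) / (K + 1))).
  rewrite -mulrA ler_wpM2l//.
  apply: (le_trans (lerD (ltW sG) (ltW sH))).
  rewrite le_eqVlt; apply/orP; left; apply/eqP; field.
  by rewrite gt_eqF// ltr_wpDl.
by rewrite ltr_pdivrMr ?ltr_wpDl// mulrC ltr_pM2l// ltrDl.
Qed.

Lemma abs_cont_id a b : abs_cont a b (id : R -> R).
Proof.
move=> e e0; exists e => // s sab _; apply: le_lt_trans.
rewrite big_seq [leRHS]big_seq; apply: ler_sum => p ps.
by have [_ pp _] := sab p ps; rewrite ger0_norm ?subr_ge0.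
Qed.

Lemma abs_cont_continuous a b F x : a < x -> x < b -> abs_cont a b F ->
  {for x, continuous F}.
Proof.
move=> ax xb ac; apply/cvgrPdist_lt => e e0.
have [d d0 hd] := ac e e0.
have xab : x \in `]a, b[ by rewrite in_itv/= ax.
have nd := nbhsx_ballx x d d0.
near=> y.
have yab : y \in `]a, b[ by near: y; exact: near_in_itvoo.
have yd : `|x - y| < d by have : ball x d y by near: y; exact nd.
move: yab; rewrite in_itv/= => /andP[ay yb].
have one p : a <= p.1 -> p.1 <= p.2 -> p.2 <= b -> p.2 - p.1 < d ->
    `|F p.2 - F p.1| < e.
  move=> ap pp pb pd; have := hd [:: p]; rewrite !big_seq1; apply=> //.
  by move=> q; rewrite inE => /eqP ->.
have [xy|yx] := leP x y.
  rewrite distrC; apply: (one (x, y)) => //=; rewrite ?ltW//.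
  by rewrite -[ltLHS]ger0_norm ?subr_ge0// distrC.
apply: (one (y, x)) => //=; rewrite ?ltW//.
by rewrite -[ltLHS]ger0_norm ?subr_ge0// ltW.
Unshelve. all: by end_near. Qed.

Definition loc_abs_cont F := forall a b, 0 < a -> a <= b -> abs_cont a b F.

Lemma loc_abs_cont_continuous F x : 0 < x -> loc_abs_cont F ->
  {for x, continuous F}.
Proof.
move=> x0 ac; apply: (@abs_cont_continuous (x / 2) (x + 1)).
- by rewrite ltr_pdivrMr// ltr_pMr// ltr1n.
- by rewrite ltrDl.
- apply: ac; first by rewrite divr_gt0.
  by rewrite ler_pdivrMr//; have := x0; lra.
Qed.

Lemma loc_abs_contD_scale F G k : loc_abs_cont F -> loc_abs_cont G ->
  loc_abs_cont (fun x => F x + k * G x).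
Proof.
move=> acF acG a b a0 ab.
apply: (@abs_cont_dom (1 + `|k|) _ _ _ F G); first by rewrite addr_ge0.
- move=> x y _ _ _.
  have -> : F y + k * G y - (F x + k * G x) = (F y - F x) + k * (G y - G x) by ring.
  apply: (le_trans (ler_normD _ _)); rewrite normrM.
  have := normr_ge0 (F y - F x); have := normr_ge0 (G y - G x).
  have := normr_ge0 k; nra.
- exact: acF.
- exact: acG.
Qed.

Lemma loc_abs_cont_divx F : loc_abs_cont F -> loc_abs_cont (fun x => F x / x).
Proof.
move=> ac a b a0 ab.
have cF : {within `[a, b], continuous (fun x => `|F x|)}.
  apply: continuous_in_subspaceT => x; rewrite inE/= in_itv/= => /andP[ax _].
  by apply: cvg_norm; apply: loc_abs_cont_continuous ac; exact: lt_le_trans ax.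
have [c _ hc] := EVT_max ab cF.
set M := `|F c| in hc.
have M0 : 0 <= M by exact: normr_ge0.
have a1 : 0 < a^-1 by rewrite invr_gt0.
apply: (@abs_cont_dom (a^-1 + M * (a^-1 * a^-1)) _ _ _ F id).
- by rewrite addr_ge0 ?mulr_ge0// ltW.
- move=> x y ax xy yb; have x0 := lt_le_trans a0 ax; have y0 := lt_le_trans x0 xy.
  have -> : F y / y - F x / x = (F y - F x) * y^-1 + F x * (x^-1 * y^-1) * (x - y).
    by field; rewrite !gt_eqF.
  apply: (le_trans (ler_normD _ _)); rewrite !normrM (distrC x y) !normfV.
  rewrite !(gtr0_norm x0) !(gtr0_norm y0).
  have yi : y^-1 <= a^-1 by rewrite lef_pV2 ?posrE// (le_trans ax).
  have xi : x^-1 <= a^-1 by rewrite lef_pV2 ?posrE.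
  have Fx : `|F x| <= M by apply: hc; rewrite in_itv/= ax (le_trans xy).
  have xi0 : 0 < x^-1 by rewrite invr_gt0.
  have yi0 : 0 < y^-1 by rewrite invr_gt0.
  have h1 : `|F y - F x| * y^-1 <= a^-1 * `|F y - F x|.
    by rewrite mulrC ler_wpM2r.
  have h2 : `|F x| * (x^-1 * y^-1) * `|y - x| <= M * (a^-1 * a^-1) * `|y - x|.
    rewrite ler_wpM2r// ler_pM ?mulr_ge0 ?(ltW xi0) ?(ltW yi0)//.
    by rewrite ler_pM ?(ltW xi0) ?(ltW yi0).
  apply: (le_trans (lerD h1 h2)).
  have := mulr_ge0 (mulr_ge0 M0 (mulr_ge0 (ltW a1) (ltW a1))) (normr_ge0 (F y - F x)).
  by have := mulr_ge0 (ltW a1) (normr_ge0 (y - x)); rewrite /=; lra.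
- exact: ac.
- exact: abs_cont_id.
Qed.

(** The derivatives up to order m exist everywhere on the half-line and are locally
absolutely continuous. Absolute continuity is required at every level, though it
follows from that of the next derivative, so that lowering the order is a
projection. *)
Fixpoint ac_order (m : nat) F : Prop :=
  loc_abs_cont F /\
  if m is m'.+1 then
    (forall x : R, 0 < x -> derivable F x 1) /\ ac_order m' (derive1 F)
  else True.

Lemma near_pos (x : R) : 0 < x -> \forall y \near x, 0 < y.
Proof. exact: lt_nbhsr. Qed.

Lemma eq_pos_derivable F G x : (forall x : R, 0 < x -> F x = G x) -> 0 < x ->
  derivable F x 1 -> derivable G x 1.
Proof.
move=> FG x0; apply: near_eq_derivable.
by have := near_pos x0; apply: filterS => y; exact: FG.
Qed.

Lemma eq_pos_derive1 F G x : (forall x : R, 0 < x -> F x = G x) -> 0 < x ->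
  derive1 F x = derive1 G x.
Proof.
move=> FG x0; rewrite !derive1E; apply: near_eq_derive.
by have := near_pos x0; apply: filterS => y; exact: FG.
Qed.

Lemma eq_loc_abs_cont F G : (forall x : R, 0 < x -> F x = G x) ->
  loc_abs_cont F -> loc_abs_cont G.
Proof.
move=> FG ac a b a0 ab; apply: (@abs_cont_dom 1 _ _ _ F F) => //; try exact: ac.
move=> x y ax xy _; have x0 := lt_le_trans a0 ax.
by rewrite mul1r (FG _ x0) (FG _ (lt_le_trans x0 xy)) lerDl.
Qed.

Lemma eq_ac_order m F G : (forall x : R, 0 < x -> F x = G x) ->
  ac_order m F -> ac_order m G.
Proof.
elim: m F G => [|m ih] F G FG /= [ac]; first by split=> //; exact: eq_loc_abs_cont ac.
move=> [dF acF]; split; [exact: eq_loc_abs_cont ac|split].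
  by move=> x x0; apply: eq_pos_derivable (dF x x0).
by apply: ih acF => x x0; exact: eq_pos_derive1.
Qed.

Lemma ac_orderW m F : ac_order m.+1 F -> ac_order m F.
Proof.
elim: m F => [|m ih] F [ac [dF acF]]; first by split.
by split=> //; split=> //; exact: ih.
Qed.

Lemma ac_orderD_scale m F G k : ac_order m F -> ac_order m G ->
  ac_order m (fun x => F x + k * G x).
Proof.
elim: m F G => [|m ih] F G [acF hF] [acG hG].
  by split=> //; exact: loc_abs_contD_scale.
split; first exact: loc_abs_contD_scale.
have [dF aF] := hF; have [dG aG] := hG.
have D (x : R) : 0 < x -> is_derive x 1 (fun x => F x + k * G x) (derive1 F x + k * derive1 G x).
  move=> x0; have hFx : is_derive x 1 F (derive1 F x).
    by rewrite derive1E; apply: DeriveDef => //; exact: dF.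
  have hGx : is_derive x 1 G (derive1 G x).
    by rewrite derive1E; apply: DeriveDef => //; exact: dG.
  by apply: is_derive_eq.
split; first by move=> x x0; case: (D x x0).
apply: eq_ac_order (ih _ _ aF aG) => x x0.
by rewrite [RHS]derive1E; have -> := @derive_val _ _ _ _ _ _ _ (D x x0).
Qed.

(** (F/x)' = F'/x - F/x^2, where F/x^2 has one order to spare. *)
Lemma ac_order_divx m F : ac_order m F -> ac_order m (fun x => F x / x).
Proof.
elim: m F => [|m ih] F acF; first by case: acF => acF _; split=> //; exact: loc_abs_cont_divx.
have [acF0 [dF aF]] := acF.
split; first exact: loc_abs_cont_divx.
have D (x : R) : 0 < x -> is_derive x 1 (fun x => F x / x) (derive1 F x / x + -1 * (F x / x / x)).
  move=> x0; have x1 : x != 0 by rewrite gt_eqF.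
  have hFx : is_derive x 1 F (derive1 F x).
    by rewrite derive1E; apply: DeriveDef => //; exact: dF.
  have hi : is_derive x 1 (fun y : R => y^-1) (- x ^- 2 *: (1 : R)).
    by apply: (@is_deriveV _ id).
  apply: (is_derive_eq (is_deriveM hFx hi)).
  by rewrite /GRing.scale/=; field.
split; first by move=> x x0; case: (D x x0).
have := ac_orderD_scale (-1) (ih _ aF) (ih _ (ih _ (ac_orderW acF))).
apply: eq_ac_order => x x0.
by rewrite [RHS]derive1E; have -> := @derive_val _ _ _ _ _ _ _ (D x x0).
Qed.

Lemma ac_order_derive1n m k F : ac_order (m + k) F -> ac_order m (derive1n k F).
Proof.
elim: k F => [|k ih] F; first by rewrite addn0.
by rewrite addnS => -[_ [_ acF]]; rewrite derive1Sn; exact: ih.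
Qed.

Lemma ac_order_MDT_regular m F : ac_order m F -> MDT_regular m.+2 F.
Proof.
move=> acF.
have [acm _] : loc_abs_cont (derive1n m F) /\ True.
  by have := @ac_order_derive1n 0 m F; rewrite add0n => /(_ acF).
split.
- move=> k x km x0; have e : m = ((m - k.+1).+1 + k)%N by rewrite addSnnS subnK.
  by move: acF; rewrite e => /ac_order_derive1n[_ [/(_ x x0)]].
- by move=> x x0; exact: loc_abs_cont_continuous acm.
- by move=> a b a0 ab; exact: acm.
Qed.

End AbsCont.

(** * Linearity of the Mellin transform *)

Section Linearity.
Context {R : realType}.
Local Notation mu := (@lebesgue_measure R).
Local Notation D := (`]0, +oo[%classic : set R).
Variable N : R.

Lemma mellin_integrableD (f g : R -> R) (k : R) :
  mellin_integrable N f -> mellin_integrable N g ->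
  mellin_integrable N (fun x => f x + k * g x).
Proof.
move=> [mf intf] [mg intg]; split.
  by apply: measurable_funD => //; exact: measurable_funM.
move=> s Ns.
have ig : mu.-integrable D (EFin \o (fun x => k * (g x * x `^ (s - 1)))).
  exact: (integrableZl mD k (intg s Ns)).
have := integrableD mD (intf s Ns) ig.
by apply: eq_integrable => // x _; rewrite /= -EFinD; congr EFin; ring.
Qed.

Lemma rmellinD (f g : R -> R) (k s : R) : N <= s ->
  mellin_integrable N f -> mellin_integrable N g ->
  rmellin (fun x => f x + k * g x) s = rmellin f s + k * rmellin g s.
Proof.
move=> Ns [mf intf] [mg intg].
have e1 := RintegralZl k mD (intg s Ns).
have ig : mu.-integrable D (EFin \o (fun x => k * (g x * x `^ (s - 1)))).
  exact: (integrableZl mD k (intg s Ns)).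
have e2 := RintegralD mD (intf s Ns) ig.
rewrite /rmellin -e1 -e2; apply: eq_Rintegral => x _; ring.
Qed.

Lemma mellin_integrable0 : mellin_integrable N (fun=> 0 : R).
Proof.
split; first exact: measurable_cst.
move=> s _; have := integrable0 (lebesgue_measure : {measure set _ -> \bar R}) D.
by apply: eq_integrable => // x _; rewrite /= mul0r.
Qed.

Lemma rmellin0 (s : R) : rmellin (fun=> 0) s = 0.
Proof.
rewrite /rmellin (_ : (fun x => _) = cst 0); last by apply/funext => x; rewrite mul0r.
by rewrite Rintegral_cst// mul0r.
Qed.

Lemma mellin_sum (I : Type) (r : seq I) (c : I -> R) (f : I -> R -> R) :
  (forall i, mellin_integrable N (f i)) ->
  mellin_integrable N (fun x => \sum_(i <- r) c i * f i x) /\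
  forall s, N <= s ->
    rmellin (fun x => \sum_(i <- r) c i * f i x) s = \sum_(i <- r) c i * rmellin (f i) s.
Proof.
move=> mf; elim: r => [|i r [ih1 ih2]].
  rewrite (_ : (fun x => _) = fun=> 0); last by apply/funext => x; rewrite big_nil.
  by split=> [|s _]; [exact: mellin_integrable0|rewrite rmellin0 big_nil].
rewrite (_ : (fun x => _) = fun x => (\sum_(i <- r) c i * f i x) + c i * f i x); last first.
  by apply/funext => x; rewrite big_cons addrC.
split; first exact: mellin_integrableD.
by move=> s Ns; rewrite rmellinD// ih2// big_cons addrC.
Qed.

Lemma rmellin_inj_eq (f g : R -> R) :
  mellin_integrable N f -> mellin_integrable N g ->
  (forall s, N <= s -> rmellin f s = rmellin g s) ->
  {ae mu, forall x, 0 < x -> f x = g x}.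
Proof.
move=> mf mg fg.
have := rmellin_inj (mellin_integrableD (-1) mf mg) _.
have z s : N <= s -> rmellin (fun x => f x + -1 * g x) s = 0.
  by move=> Ns; rewrite rmellinD// fg// mulN1r subrr.
move=> /(_ z); apply: filterS; first exact: (ae_filter_ringOfSetsType mu).
by move=> x + x0 => /(_ x0)/eqP; rewrite mulN1r subr_eq0 => /eqP.
Qed.

End Linearity.

(** * Regularity gained by the inverse of x d/dx *)

Section TailRegularity.
Context {R : realType}.
Local Notation mu := (@lebesgue_measure R).
Variables (N : R) (f : R -> R).
Hypothesis N1 : 1 < N.
Hypothesis mf : mellin_integrable N f.

Let phi (a : R) := (fun t => f t / t) \_ `]a, +oo[.

Let phi_int (a : R) : 0 < a -> mu.-integrable setT (EFin \o phi a).
Proof.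
move=> a0; rewrite -restrict_EFin.
have ma : measurable (`]a, +oo[%classic : set (measurableTypeR R)) by exact: measurable_itv.
exact: (iffLR (integrable_mkcond _ ma) (integrable_divx N1 mf a0)).
Qed.

Let tail_phi (a x y : R) : 0 < a -> a <= x -> x <= y ->
  tail f y - tail f x = \int[mu]_(t in `]x, y]) phi a t.
Proof.
move=> a0 ax xy; rewrite (tailB N1 mf (lt_le_trans a0 ax) xy).
apply: eq_Rintegral => t; rewrite inE/= in_itv/= => /andP[xt _].
by rewrite /phi patchE mem_set//= in_itv/= andbT (le_lt_trans ax).
Qed.

(** Near x, [tail] f differs by a constant from the primitive based at a, to which
the fundamental theorems of calculus apply. *)
Let tail_is_derive (a x v : R) : 0 < a -> a < x ->
  let F y := \int[mu]_(t in `]a, y]) phi a t in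
  derivable F x 1 /\ derive1 F x = v -> derivable (tail f) x 1 /\ derive1 (tail f) x = v.
Proof.
move=> a0 ax F [dF vF].
have e : \forall y \near x, tail f a + F y = tail f y.
  have := lt_nbhsr ax; apply: filterS => y ay.
  by rewrite /F -(tail_phi a0 (lexx a) (ltW ay)) subrKC.
have hF : is_derive x 1 F v by apply: DeriveDef; [exact: dF|rewrite -derive1E].
have hT : is_derive x 1 (fun y => tail f a + F y) v.
  by apply: (is_derive_eq (is_deriveD (is_derive_cst (tail f a) x 1) hF)); rewrite add0r.
have [d <-] := near_eq_is_derive e hT.
by split; [exact: d|rewrite derive1E].
Qed.

(** Lebesgue differentiation from each of the base points 1/(k+1); they exhaust the
half-line. *)
Lemma tail_derive1_ae :
  {ae mu, forall x, 0 < x -> derivable (tail f) x 1 /\ derive1 (tail f) x = f x / x}.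
Proof.
have : {ae mu, forall x, forall k : nat, k.+1%:R^-1 < x ->
    derivable (tail f) x 1 /\ derive1 (tail f) x = f x / x}.
  apply: ae_foralln => k; set a : R := k.+1%:R^-1.
  have a0 : 0 < a by rewrite invr_gt0.
  have il y : mu.-integrable `]a, y] (EFin \o phi a).
    by apply: integrableS (phi_int a0).
  have lH : locally_integrable setT (phi a).
    exact: (integrable_locally _ (integrable_divx N1 mf a0)).
  have := FTC1 il lH; apply: filterS; first exact: (ae_filter_ringOfSetsType mu).
  move=> x dF ax; apply: (tail_is_derive a0 ax).
  have [|? ->] := dF; first by [].
  by split=> //; rewrite /phi patchE mem_set//= in_itv/= ax.
apply: filterS; first exact: (ae_filter_ringOfSetsType mu).
move=> x h x0; have [k kx] : exists k : nat, k.+1%:R^-1 < x.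
  exists (Num.truncn x^-1); rewrite invf_plt ?posrE//.
  by have /truncn_itv/andP[] : 0 <= x^-1 by rewrite invr_ge0 ltW.
exact: h kx.
Qed.

Lemma tail_derive1 (x : R) : 0 < x -> {for x, continuous f} ->
  derivable (tail f) x 1 /\ derive1 (tail f) x = f x / x.
Proof.
move=> x0 cf; pose a := x / 2.
have a0 : 0 < a by rewrite divr_gt0.
have ax : a < x by rewrite ltr_pdivrMr// ltr_pMr// ltr1n.
apply: (tail_is_derive a0 ax).
have il : mu.-integrable `]a, (x + 1)] (EFin \o phi a).
  by apply: integrableS (phi_int a0).
have phix y : a < y -> phi a y = f y / y.
  by move=> ay; rewrite /phi patchE mem_set//= in_itv/= ay.
have cphi : {for x, continuous (phi a)}.
  have c0 : {for x, continuous (fun y => f y / y)}.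
    by apply: cvgM => //; apply: cvgV; [rewrite gt_eqF|exact: cvg_id].
  rewrite /prop_for /continuous_at phix//.
  apply: cvg_trans c0; apply: near_eq_cvg.
  by have := lt_nbhsr ax; apply: filterS => y /phix.
have xx1 : x < x + 1 by rewrite ltrDl.
have [//|? ->] := continuous_FTC1 xx1 il _ cphi.
by rewrite phix.
Qed.

Let intervals (s : seq (R * R)) : set R := \big[setU/set0]_(p <- s) `]p.1, p.2]%classic.

Let m_itvs (s : seq (R * R)) : measurable (intervals s : set (measurableTypeR R)).
Proof. by apply: bigsetU_measurable => p _; exact: measurable_itv. Qed.

Let mu_intervals (s : seq (R * R)) : {in s, forall p, p.1 <= p.2} ->
  (mu (intervals s) <= (\sum_(p <- s) (p.2 - p.1))%:E)%E.
Proof.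
elim: s => [|p s ih] hs; first by rewrite /intervals !big_nil measure0.
have mp : measurable (`]p.1, p.2]%classic : set (measurableTypeR R)) by exact: measurable_itv.
rewrite /intervals !big_cons; apply: (le_trans (measureU2 (@lebesgue_measure R) mp (m_itvs s))).
rewrite EFinD; apply: leeD; last first.
  by apply: ih => q qs; apply: hs; rewrite inE qs orbT.
have pp : p.1 <= p.2 by apply: hs; rewrite mem_head.
apply: (@le_trans _ _ (lebesgue_measure (`]p.1, p.2]%classic : set R))) => //.
rewrite lebesgue_measure_itv/= lte_fin; case: ifP => _; last by rewrite lee_fin subr_ge0.
by rewrite -EFinB lexx.
Qed.

(** The half-open intervals of the family are disjoint even when they share end
points. *)
Let integral_intervals (g : R -> R) (s : seq (R * R)) :
  mu.-integrable setT (EFin \o g) ->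
  pairwise (fun p q => (p.2 <= q.1) || (q.2 <= p.1)) s ->
  \sum_(p <- s) \int[mu]_(t in `]p.1, p.2]) g t = \int[mu]_(t in intervals s) g t.
Proof.
move=> ig; elim: s => [|p s ih]; first by rewrite /intervals !big_nil Rintegral_set0.
rewrite pairwise_cons => /andP[ps pw]; rewrite /intervals !big_cons ih//.
have mp : measurable (`]p.1, p.2]%classic : set (measurableTypeR R)) by exact: measurable_itv.
have mU := measurableU _ _ mp (m_itvs s).
apply/esym; apply: (Rintegral_setU mp (m_itvs s)).
  exact: (integrableS measurableT mU (@subsetT _ _) ig).
apply/disj_setPS => t [/=]; rewrite in_itv/= => /andP[pt tp].
rewrite /intervals -bigcup_seq => -[q /= qs]; rewrite in_itv/= => /andP[qt tq].
have /orP[h|h] := allP ps q qs.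
  by have := lt_le_trans qt (le_trans tp h); rewrite ltxx.
by have := lt_le_trans pt (le_trans tq h); rewrite ltxx.
Qed.

(** Absolute continuity of the integral, applied to the union of the intervals, a
set whose measure is at most their total length. *)
Lemma tail_loc_abs_cont : loc_abs_cont (tail f).
Proof.
move=> a b a0 ab e e0.
have [d [d0 hd]] := integral_normr_continuous (phi_int a0) e0.
exists d => // s sab pw sd.
have inorm := integrable_norm (phi_int a0).
apply: (@le_lt_trans _ _ (\sum_(p <- s) \int[mu]_(t in `]p.1, p.2]) `|phi a t|)).
  rewrite big_seq [leRHS]big_seq; apply: ler_sum => p ps.
  have [ap pp pb] := sab p ps.
  rewrite (tail_phi a0 ap pp).
  have mp : measurable (`]p.1, p.2]%classic : set (measurableTypeR R)) by exact: measurable_itv.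
  exact: (le_normr_Rintegral mp (integrableS measurableT mp (@subsetT _ _) (phi_int a0))).
rewrite (integral_intervals inorm pw); apply: hd; first exact: m_itvs.
apply: (le_lt_trans (mu_intervals _)); last by rewrite lte_fin.
by move=> p ps; have [] := sab p ps.
Qed.

Lemma tail_ac_order m : ac_order m f -> ac_order m.+1 (tail f).
Proof.
move=> acf; split; first exact: tail_loc_abs_cont.
have cf x : 0 < x -> {for x, continuous f}.
  by move=> x0; apply: loc_abs_cont_continuous => //; case: m acf => [|m] [].
split; first by move=> x x0; have [] := tail_derive1 x0 (cf x x0).
apply: eq_ac_order (ac_order_divx acf) => x x0.
by have [_ ->] := tail_derive1 x0 (cf x x0).
Qed.

End TailRegularity.

(** * Regular representatives *)

Section Representative.
Context {R : realType}.
Local Notation mu := (@lebesgue_measure R).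

Lemma iter_xD_eq (F G : R -> R) j : (forall x : R, 0 < x -> F x = G x) ->
  forall x, 0 < x -> iter j xD F x = iter j xD G x.
Proof.
move=> FG; elim: j => [//|j ih] x x0 /=.
by rewrite /xD (eq_pos_derive1 ih x0).
Qed.

(** The transforms say that the f_j are formally the iterates (x d/dx)^j f_0. The
representative is built from the top: the i-th tail of f_n has the transform of
f_{n-i}, hence equals it a.e., and has n tails in hand. For j < n the iterates of
x d/dx are then computed everywhere, because the function differentiated is the
tail of a continuous function; the last one, f_n itself, only a.e. *)
Lemma regular_representative (N : R) (n : nat) (f : nat -> R -> R) : 1 < N ->
  (forall j, (j <= n)%N -> mellin_integrable N (f j)) ->
  (forall j s, (j <= n)%N -> N <= s -> rmellin (f j) s = (- s) ^+ j * rmellin (f 0) s) ->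
  exists2 omega : R -> R, MDT_regular n.+1 omega &
    forall j, (j <= n)%N ->
      {ae mu, forall x, 0 < x -> iter j xD omega x = f j x}.
Proof.
move=> N1 mf Mf; pose g i := iter i tail (f n).
have mg i : mellin_integrable N (g i).
  by elim: i => [|i ih]; [exact: mf|exact: tail_mellin_integrable].
have Mg i s : (i <= n)%N -> N <= s -> rmellin (g i) s = (- s) ^+ (n - i) * rmellin (f 0) s.
  move=> + Ns; elim: i => [_|i ih lin]; first by rewrite subn0 -Mf.
  have s0 : s != 0 by rewrite gt_eqF// (lt_le_trans _ Ns)// (lt_trans _ N1).
  rewrite /g iterS (rmellin_tail N1 (mg i) Ns) ih ?(ltnW lin)//.
  rewrite (_ : (n - i = (n - i.+1).+1)%N); last by rewrite subnSK.
  by rewrite exprS; field.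
have ge i : (i <= n)%N -> {ae mu, forall x, 0 < x -> g i x = f (n - i)%N x}.
  move=> lin; apply: (rmellin_inj_eq (mg i)); first by apply: mf; exact: leq_subr.
  by move=> s Ns; rewrite Mg// [RHS]Mf// leq_subr.
have acg i : ac_order i (g i.+1).
  elim: i => [|i ih]; last exact: (tail_ac_order N1 (mg i.+1) ih).
  by split=> //; exact: (tail_loc_abs_cont N1 (mg 0)).
exists (g n).
  by case: (n) (acg) => [//|m] h; exact: ac_order_MDT_regular.
have xDg j x : (j < n)%N -> 0 < x -> iter j xD (g n) x = g (n - j)%N x.
  elim: j x => [|j ih] x jn x0; first by rewrite subn0.
  have jn' : (j < n)%N by exact: ltnW.
  rewrite iterS /xD (eq_pos_derive1 (fun y => ih y jn') x0).
  have -> : (n - j = (n - j.+1).+1)%N by rewrite subnSK.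
  have c : {for x, continuous (g (n - j.+1)%N)}.
    rewrite -[(n - j.+1)%N]prednK ?subn_gt0//.
    apply: loc_abs_cont_continuous => //.
    by have := acg (n - j.+1).-1; case: (n - j.+1).-1 => [|?] [].
  have [_ e] := tail_derive1 N1 (mg (n - j.+1)%N) x0 c.
  by rewrite /g iterS e mulrC divfK// gt_eqF.
move=> j; rewrite leq_eqVlt => /predU1P[->|jn]; last first.
  have := ge (n - j)%N (leq_subr _ _); apply: filterS; first exact: (ae_filter_ringOfSetsType mu).
  by move=> x + x0 => /(_ x0); rewrite subKn ?xDg// ltnW.
case: (posnP n) => [n0|n0].
  by rewrite n0 /g n0; apply: aeW.
have := tail_derive1_ae N1 (mg 0); apply: filterS; first exact: (ae_filter_ringOfSetsType mu).
move=> x h x0; have [_ e] := h x0.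
rewrite -{1}(prednK n0) iterS /xD.
have n1 : (n.-1 < n)%N by rewrite prednK.
rewrite (eq_pos_derive1 (fun y => xDg n.-1 y n1) x0).
have -> : (n - n.-1 = 1)%N by rewrite -{1}(prednK n0) subSnn.
by rewrite [g 1]/(tail (f n)) e mulrC divfK// gt_eqF.
Qed.

(** For n >= 2 both functions are continuous, and a neighbourhood of a point where
they differ has positive measure. *)
Lemma MDT_regular_ae_eq (n : nat) (F G : R -> R) : MDT_regular n F -> MDT_regular n G ->
  {ae mu, forall x, 0 < x -> F x = G x} ->
  (1 < n)%N -> forall x : R, 0 < x -> F x = G x.
Proof.
move=> rF rG FG n1.
have cont H : MDT_regular n H -> forall x : R, 0 < x -> {for x, continuous H}.
  case: n n1 {rF rG} => [//|[//|m]] _ [dH cH _] x x0.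
  case: m dH cH => [|m] dH cH; first exact: cH.
  by apply/differentiable_continuous/derivable1_diffP; exact: (dH 0%N).
pose A := [set x : R | 0 < x] `&` [set x | F x != G x].
move=> x x0; apply/eqP/negPn/negP => FGx.
have cFG : {for x, continuous (fun y => F y - G y)}.
  by apply: cvgB; exact: cont.
have /cvgrPdist_lt/(_ `|F x - G x|) := cFG.
rewrite normr_gt0 subr_eq0 => /(_ FGx) near_ne.
have near_pos := near_pos x0.
have [e /= e0 he] : exists2 e : R, 0 < e & ball x e `<=` [set y | 0 < y /\ F y != G y].
  have : \forall y \near x, 0 < y /\ F y != G y.
    near=> y; split; first by near: y.
    have : `|F x - G x - (F y - G y)| < `|F x - G x| by near: y.
    by apply: contraTneq => ->; rewrite subrr subr0 ltxx.
  by case/nbhs_ballP => e /= e0 he; exists e.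
have [Z [mZ Z0 sZ]] := FG.
have : (lebesgue_measure (ball x e) <= lebesgue_measure Z)%E.
  apply: le_measure; rewrite ?inE//; first exact: measurable_ball.
  by move=> y /he [y0 ne]; apply: sZ => /= /(_ y0) /eqP; rewrite (negbTE ne).
have -> : lebesgue_measure Z = 0%E by exact: Z0.
by rewrite lebesgue_measure_ball ?(ltW e0)// leNgt lte_fin mulrn_wgt0.
Unshelve. all: by end_near. Qed.

End Representative.

(** * Linear independence in a polynomial ensemble *)

Section PolynomialEnsemble.
Context {R : realType}.
Local Notation mu := (@lebesgue_measure R).

(** The preimages of a null set under the coordinate maps are null, by induction on
the construction of the product measure. *)
Lemma ae_tuple n (P : R -> Prop) : {ae mu, forall y, P y} ->
  {ae @lebesgue_tuple R n, forall x, forall k, P (tnth x k)}.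
Proof.
move=> [Z [mZ Z0 sZ]]; elim: n => [|n [Z' [mZ' Z'0 sZ']]].
  by apply: aeW => x [].
pose A := [set t : n.+1.-tuple (measurableTypeR R) | Z (thead t)].
pose B := [set t : n.+1.-tuple (measurableTypeR R) | Z' [tuple of behead t]].
have mA : measurable A.
  by rewrite -[A]setTI; exact: (measurable_tnth (ord0 : 'I_n.+1)).
have mB : measurable B.
  by rewrite -[B]setTI; exact: measurable_behead.
exists (A `|` B); split; first exact: measurableU.
- apply: null_set_setU => //.
  + transitivity (((@lebesgue_measure R) \x lebesgue_tuple n)%E (Z `*` setT)).
      by rewrite /= /cons_measure /pushforward; congr (_ _); apply/seteqP; split => -[x t] // [].
    by rewrite product_measure1E// [X in (X * _)%E]Z0 mul0e.
  + transitivity (((@lebesgue_measure R) \x lebesgue_tuple n)%E (setT `*` Z')).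
      rewrite /= /cons_measure /pushforward; congr (_ _); apply/seteqP; split => -[x t] /=.
        by move=> h; split=> //; move: h; rewrite /B /=; congr (Z' _); exact: val_inj.
      by move=> [_]; rewrite /B /=; congr (Z' _); exact: val_inj.
    by rewrite product_measure1E// [X in (_ * X)%E]Z'0 mule0.
- move=> t; apply: contra_notP => nAB k.
  have nA : ~ Z (thead t) by move=> h; apply: nAB; left.
  have nB : ~ Z' [tuple of behead t] by move=> h; apply: nAB; right.
  case: (unliftP ord0 k) => [j ->|->].
    have /(_ j) : forall k, P (tnth [tuple of behead t] k).
      by apply: contrapT => h; apply: nB; apply: sZ'.
    rewrite tnth_behead (_ : inord j.+1 = lift ord0 j)//.
    by apply: val_inj; rewrite /= inordK ?ltnS.
  apply: contrapT => h; apply: nA; apply: sZ => /= Pt; exact: h.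
Qed.

Lemma measurable_PE_density n (v : 'I_n -> R -> R) (Z : R) :
  (forall j, measurable_fun setT (v j)) -> measurable_fun setT (PE_density v Z).
Proof.
move=> mv; have mt k : measurable_fun setT
    (fun x : n.-tuple (measurableTypeR R) => (tnth x k : R)) := measurable_tnth k.
apply: measurable_funM.
  apply: measurable_funM => //; apply: measurable_prod => k _.
  under eq_fun do rewrite big_mkcond.
  apply: measurable_prod => j _; case: (j < k)%N; last exact: measurable_cst.
  exact: measurable_funB.
rewrite /determinant; apply: measurable_sum => s.
apply: measurable_funM => //; apply: measurable_prod => k _.
under eq_fun do rewrite mxE.
exact: measurableT_comp (mv k) (mt _).
Qed.

(** A linear relation among the functions is one among the rows of the matrix
[v_j(x_k)] for almost every x, so the density would be 0 a.e., against its total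
mass 1. *)
Lemma is_PE_free n (v : 'I_n -> R -> R) : is_PE (fun j => zero_ext (v j)) ->
  forall c : 'I_n -> R,
  {ae mu, forall x, 0 < x -> \sum_j c j * v j x = 0} -> forall j, c j = 0.
Proof.
move=> [iv [Z Z0 [_ intZ]]] c cv j0; apply/eqP/negPn/negP => cj0.
have mv j : measurable_fun setT (zero_ext (v j)).
  pose k0 := Ordinal (leq_ltn_trans (leq0n j) (ltn_ord j)).
  have /integrableP[/measurable_EFinP] := iv j k0.
  by under eq_fun do rewrite expr0 mul1r.
have [/eqP] : (1 : \bar R)%E = 0%E; last by rewrite oner_eq0.
rewrite -intZ -[RHS](integral0 (lebesgue_tuple n) setT).
apply: ae_eq_integral => //.
  by apply/measurable_EFinP; exact: measurable_PE_density.
have := ae_tuple n cv.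
apply: filterS; first exact: (ae_filter_ringOfSetsType (lebesgue_tuple n)).
move=> x hx _ /=; congr EFin; rewrite /PE_density.
apply/eqP; rewrite mulf_eq0; apply/orP; right; apply/det0P.
exists (\row_j c j).
  by apply/negP => /eqP/rowP/(_ j0)/eqP; rewrite !mxE (negbTE cj0).
apply/rowP => k; rewrite !mxE.
under eq_bigr do rewrite !mxE.
have [xk|xk] := ltP 0 (tnth x k).
  by rewrite -[RHS](hx k xk); apply: eq_bigr => j _; rewrite /zero_ext xk.
by apply: big1 => j _; rewrite /zero_ext ltNge xk mulr0.
Qed.

End PolynomialEnsemble.

(** * The functional equation of the Gamma function *)

Section GammaShift.
Context {R : realType}.
Implicit Type z : R[i].

Lemma Re_add z1 z2 : complex.Re (z1 + z2) = complex.Re z1 + complex.Re z2.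
Proof. by case: z1 z2 => ? ? []. Qed.

Lemma Re_nat (k : nat) : complex.Re (k%:R : R[i]) = k%:R.
Proof. by elim: k => [//|k ih]; rewrite -natr1 Re_add ih /= natr1. Qed.

Lemma Re_gt0_neq0 z : 0 < complex.Re z -> z != 0.
Proof. by apply: contraTneq => ->; rewrite ltxx. Qed.

Lemma Re_le_normc z : complex.Re z <= ComplexField.Normc.normc z.
Proof.
case: z => x y /=; apply: (le_trans (ler_norm x)).
by rewrite -sqrtr_sqr ler_sqrt ?lerDl ?sqr_ge0// addr_ge0 ?sqr_ge0.
Qed.

Lemma normc_ge0 z : 0 <= ComplexField.Normc.normc z.
Proof. by case: z => x y; exact: sqrtr_ge0. Qed.

Lemma cexp_shift z (n : nat) : cexp ((z + 1) * (ln (n.+1%:R : R))%:C) =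
  cexp (z * (ln (n.+1%:R : R))%:C) * n.+1%:R.
Proof.
have n0 : 0 < n.+1%:R :> R by rewrite ltr0n.
set r := ln _.
have er : expR r = n.+1%:R by rewrite /r lnK// posrE.
case: z => x y; rewrite /cexp /= !mulr0 !subr0 !add0r.
have -> : (n.+1%:R : R[i]) = (n.+1%:R : R)%:C by rewrite rmorph_nat.
rewrite addr0 mulrDl mul1r expRD er; simpc.
by congr (_ +i* _); ring.
Qed.

(** The index n+1 on both sides makes the powers of N in the two Gauss products
comparable: they differ by a factor N = n+1 exactly, and the products of linear
factors by their end terms. *)
Lemma gauss_gamma_shift z n : 0 < complex.Re z ->
  gauss_gamma (z + 1) n.+1 =
  gauss_gamma z n.+1 * (z * (n.+1%:R / (z + 1 + n.+1%:R))).
Proof.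
move=> z0; rewrite /gauss_gamma cexp_shift.
have zk (k : nat) : z + k%:R != 0.
  by apply: Re_gt0_neq0; rewrite Re_add Re_nat ltr_wpDr.
rewrite [in LHS]big_ord_recr [in RHS]big_ord_recl /= addr0.
under [in RHS]eq_bigr => k _ do rewrite /bump /= natrD addrA.
set Q := \prod_(k < n.+1) _.
have Q0 : Q != 0 by apply/prodf_neq0 => k _; rewrite -addrA nat1r zk.
have zn : z + 1 + n.+1%:R != 0 by rewrite -addrA nat1r zk.
have z00 : z != 0 by exact: Re_gt0_neq0.
move: (n.+1%:R) zn => m zn; move: (_`!%:R) (cexp _) => F C.
by field; rewrite zn Q0 z00.
Qed.

Lemma cvg_gauss_factor z : 0 < complex.Re z ->
  (n.+1%:R / (z + 1 + n.+1%:R) : R[i]^o) @[n --> \oo] --> (1 : R[i]^o).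
Proof.
move=> z0; apply/cvgrPdist_lt => e e0.
have [e1 e10 ->] : exists2 e1 : R, 0 < e1 & e = e1%:C.
  by case: e e0 => x y; rewrite ltcE /= => /andP[/eqP y0 x0]; exists x => //; rewrite y0.
have [M hM] : exists M : nat, ComplexField.Normc.normc (z + 1) < e1 * M%:R.
  exists (Num.bound (ComplexField.Normc.normc (z + 1) / e1)).
  rewrite -ltr_pdivrMl// mulrC; apply: archi_boundP.
  by rewrite divr_ge0 ?(ltW e10)// normc_ge0.
near=> n.
have nM : (M <= n.+1)%N by rewrite ltnW// ltnS; near: n; exact: nbhs_infty_ge.
have zk : z + 1 + n.+1%:R != 0.
  by apply: Re_gt0_neq0; rewrite !Re_add Re_nat /= !addr_gt0.
have -> : 1 - n.+1%:R / (z + 1 + n.+1%:R) = (z + 1) / (z + 1 + n.+1%:R).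
  by move: (n.+1%:R) zk => m zk; field.
rewrite /Num.norm/= ltcR ComplexField.Normc.normcM ComplexField.Normc.normcV.
have r1 : n.+1%:R <= ComplexField.Normc.normc (z + 1 + n.+1%:R).
  apply: le_trans (Re_le_normc _); rewrite !Re_add Re_nat lerDr.
  by rewrite addr_ge0// ltW.
rewrite ltr_pdivrMr ?(lt_le_trans _ r1)//.
apply: (lt_le_trans hM); rewrite ler_pM2l// (le_trans _ r1)// ler_nat.
Unshelve. all: by end_near. Qed.

(** The two Gauss products differ by a factor that tends to z <> 0, so they
converge or diverge together; the identity of the limits follows in either
case. *)
Lemma Gamma_succ z : 0 < complex.Re z -> Gamma (z + 1) = z * Gamma z.
Proof.
move=> z0; pose g w : nat -> R[i]^o := fun n => gauss_gamma w n.+1.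
have z00 : z != 0 by exact: Re_gt0_neq0.
have hd : hausdorff_space (R[i]^o) by exact: norm_hausdorff.
have sh w (l : R[i]^o) : (g w n @[n --> \oo] --> l) =
    (gauss_gamma w n @[n --> \oo] --> l) by exact (cvg_shiftS (gauss_gamma w) (nbhs l)).
have lim_eq (u : nat -> R[i]^o) l : u n @[n --> \oo] --> l -> limn u = l.
  by move=> ul; exact: (cvg_lim hd ul).
have lim_shift w : Gamma w = limn (g w).
  have [/cvg_ex[l gl]|ng] := pselect (cvgn (g w)).
    have gl' : gauss_gamma w n @[n --> \oo] --> (l : R[i]^o).
      by case: _ / (sh w l).
    exact: (etrans (lim_eq _ _ gl') (esym (lim_eq _ _ gl))).
  have ng' : ~ cvgn (gauss_gamma w).
    move=> /cvg_ex[l gl]; apply: ng; apply/cvg_ex; exists l.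
    by case: _ / (esym (sh w l)).
  exact: (etrans (dvgP ng') (esym (dvgP ng))).
pose t (n : nat) : R[i]^o := z * (n.+1%:R / (z + 1 + n.+1%:R)).
have tz : t n @[n --> \oo] --> (z : R[i]^o).
  by rewrite -[X in _ --> X]mulr1; apply: cvgMl_tmp; exact: cvg_gauss_factor.
have gS : g (z + 1) = fun n => g z n * t n.
  by apply/funext => n; rewrite /g gauss_gamma_shift.
rewrite !lim_shift.
have [/cvg_ex[l gl]|ng] := pselect (cvgn (g z)).
  rewrite (lim_eq _ _ gl) gS mulrC; apply: lim_eq.
  exact: (cvgM gl tz).
have ng1 : ~ cvgn (g (z + 1)).
  move=> /cvg_ex[l gl]; apply: ng; apply/cvg_ex; exists (l * z^-1).
  have -> : g z = fun n => g (z + 1) n * (t n)^-1.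
    apply/funext => n; rewrite gS mulfK// /t mulf_neq0// mulf_neq0 ?pnatr_eq0//.
    by rewrite invr_eq0; apply: Re_gt0_neq0; rewrite !Re_add Re_nat /= !addr_gt0.
  by apply: cvgM gl _; apply: cvgV.
(* a divergent sequence has the default limit 0, so both sides vanish *)
have e0 : limn (g z) = 0 by exact: (dvgP ng).
by rewrite e0 mulr0; exact: (dvgP ng1).
Qed.

Lemma Gamma_addn z (m n : nat) : 0 < complex.Re z -> (m <= n)%N ->
  Gamma (z + n%:R) = (\prod_(m <= l < n) (z + l%:R)) * Gamma (z + m%:R).
Proof.
move=> z0; elim: n => [|n ih]; first by rewrite leqn0 => /eqP ->; rewrite big_geq// mul1r.
rewrite leq_eqVlt => /predU1P[->|mn]; first by rewrite big_geq// mul1r.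
rewrite big_nat_recr//= mulrAC -ih// -natr1 addrA Gamma_succ 1?mulrC//.
by rewrite Re_add Re_nat ltr_wpDr.
Qed.

End GammaShift.

(** * Indices on the step line *)

Section StepLine.

Lemma step_line_diff r (nn : 'I_r -> nat) (i j : 'I_r) :
  step_line nn -> (nn i <= (nn j).+1)%N.
Proof.
case: r nn i j => [|r] nn i j [mono ends]; first by case: i.
have h0 := mono ord0 i (leq0n i).
have h1 := mono j ord_max (leq_ord j).
have := ends ord0 ord_max erefl erefl; lia.
Qed.

(** Two indices n, m of the step line are comparable componentwise: for i <= j,
n_j < m_j <= m_i < n_i would be a drop of at least two. Comparable indices with
equal sums coincide. *)
Lemma step_line_inj r (nn mm : 'I_r -> nat) : step_line nn -> step_line mm ->
  (\sum_(j < r) nn j = \sum_(j < r) mm j)%N -> nn = mm.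
Proof.
move=> sn sm e.
suff [le|le] : (forall i, nn i <= mm i)%N \/ (forall i, mm i <= nn i)%N.
- apply/funext => i; apply/eqP; have /eqP := e.
  have := leqif_sum (fun (k : 'I_r) (_ : true) => leqif_eq (le k)).
  by move=> [_ ->] /forallP/(_ i).
- apply/funext => i; apply/eqP; have /eqP := esym e.
  have := leqif_sum (fun (k : 'I_r) (_ : true) => leqif_eq (le k)).
  by move=> [_ ->] /forallP/(_ i); rewrite eq_sym.
have [/forallP ?|] := boolP [forall i, (nn i <= mm i)%N]; first by left.
have [/forallP ?|] := boolP [forall i, (mm i <= nn i)%N]; first by right.
rewrite !negb_forall => /existsP[j mnj] /existsP[i mni]; exfalso.
move: mnj mni; rewrite -!ltnNge => mnj mni.
have [ij|ji] := leqP i j.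
- have := sm.1 i j ij; have := step_line_diff i j sn; lia.
- have := sn.1 j i (ltnW ji); have := step_line_diff j i sm; lia.
Qed.

End StepLine.

(** * Spans up to null sets *)

Section Spans.
Context {R : realType}.
Local Notation mu := (@lebesgue_measure R).

Lemma ae_forall_fin (I : finType) (P : I -> R -> Prop) :
  (forall i, {ae mu, forall x, P i x}) -> {ae mu, forall x, forall i, P i x}.
Proof.
move=> h; have aF := ae_filter_ringOfSetsType mu.
by apply: filter_forall.
Qed.

Lemma ae_imply (P Q : R -> Prop) : (forall x, P x -> Q x) ->
  {ae mu, forall x, P x} -> {ae mu, forall x, Q x}.
Proof.
by move=> PQ; apply: filterS; first exact: (ae_filter_ringOfSetsType mu).
Qed.

Lemma span_ae_mem (I : finType) (f : I -> R -> R) i : span_ae f (f i).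
Proof.
exists (fun k => (k == i)%:R); apply: aeW => x _.
rewrite (bigD1 i)//= eqxx mul1r big1 ?addr0// => k /negbTE ->.
by rewrite mul0r.
Qed.

Lemma span_ae_sub (I J : finType) (f : I -> R -> R) (g : J -> R -> R) :
  (forall i, span_ae g (f i)) -> span_ae f `<=` span_ae g.
Proof.
move=> fg h [c hc].
have [d hd] := choice fg.
exists (fun j => \sum_i c i * d i j).
apply: (ae_imply _ (ae_forall_fin (I := option I)
  (P := fun o x => if o is Some i then 0 < x -> f i x = \sum_j d i j * g j x
                   else 0 < x -> h x = \sum_i c i * f i x) _)); last by case.
move=> x hx x0; rewrite (hx None x0).
under eq_bigr => i _ do rewrite (hx (Some i) x0) mulr_sumr.
rewrite exchange_big; apply: eq_bigr => j _.
by rewrite mulr_suml; apply: eq_bigr => i _; rewrite mulrA.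
Qed.

Lemma eq_span_ae (I : finType) (f g : I -> R -> R) :
  (forall i, {ae mu, forall x, 0 < x -> f i x = g i x}) -> span_ae f = span_ae g.
Proof.
have sub (f1 g1 : I -> R -> R) :
    (forall i, {ae mu, forall x, 0 < x -> f1 i x = g1 i x}) ->
    span_ae f1 `<=` span_ae g1.
  move=> fg; apply: span_ae_sub => i; have [c hc] := span_ae_mem g1 i.
  exists c; apply: (ae_imply _ (ae_forall_fin (I := bool) (P := fun b x =>
    if b then 0 < x -> f1 i x = g1 i x
    else 0 < x -> g1 i x = \sum_k c k * g1 k x) _)); last by case.
  by move=> x hx x0; rewrite (hx true x0) -(hx false x0).
move=> fg; apply/seteqP; split; apply: sub => // i.
by apply: ae_imply (fg i) => x h /h.
Qed.

Lemma reindex_span_ae (I J : finType) (e : J -> I) (f : I -> R -> R) :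
  bijective e -> span_ae (fun j => f (e j)) = span_ae f.
Proof.
move=> [e' eK e'K]; apply/seteqP; split; apply: span_ae_sub => i.
  exact: span_ae_mem.
by rewrite -[in f i](e'K i); exact: (span_ae_mem (fun j => f (e j))).
Qed.

Definition ae_free (I : finType) (f : I -> R -> R) : Prop :=
  forall c : I -> R, {ae mu, forall x, 0 < x -> \sum_i c i * f i x = 0} ->
  forall i, c i = 0.

(** Two families of n functions with the same span are related by square matrices,
one-sided inverses of which are two-sided. *)
Lemma ae_free_span n (v f : 'I_n -> R -> R) :
  ae_free v -> span_ae v = span_ae f -> ae_free f.
Proof.
move=> freev vf.
have /choice[C hC] i : span_ae f (v i) by rewrite -vf; exact: span_ae_mem.
have /choice[E hE] i : span_ae v (f i) by rewrite vf; exact: span_ae_mem.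
pose MC : 'M[R]_n := \matrix_(i, j) C i j.
pose ME : 'M[R]_n := \matrix_(i, j) E i j.
have CE : MC *m ME = 1%:M.
  apply/matrixP => i k; apply/eqP; rewrite -subr_eq0; apply/eqP.
  apply: (freev (fun k => (MC *m ME) i k - (1%:M : 'M[R]_n) i k)).
  apply: (ae_imply _ (ae_forall_fin (P := fun o x => match o with
    | inl l => 0 < x -> v l x = \sum_j C l j * f j x
    | inr l => 0 < x -> f l x = \sum_j E l j * v j x end)
    (I := ('I_n + 'I_n)%type) _)); last by case.
  move=> x hx x0; under eq_bigr do rewrite mulrBl.
  rewrite big_split sumrN /= [X in _ - X](_ : _ = v i x); last first.
    rewrite (bigD1 i)//= mxE eqxx mul1r big1 ?addr0// => l li.
    by rewrite mxE eq_sym (negbTE li) mul0r.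
  rewrite (hx (inl i) x0); apply/eqP; rewrite subr_eq0; apply/eqP.
  under [RHS]eq_bigr => j _ do rewrite (hx (inr j) x0) mulr_sumr.
  rewrite [RHS]exchange_big; apply: eq_bigr => l _.
  by rewrite mxE mulr_suml; apply: eq_bigr => j _; rewrite !mxE mulrA.
have EC := mulmx1C CE.
move=> u hu; pose U : 'rV[R]_n := \row_i u i.
suff UE0 : U *m ME = 0.
  move=> i; have /rowP/(_ i) : U = 0 by rewrite -[U]mulmx1 -EC mulmxA UE0 mul0mx.
  by rewrite !mxE.
apply/rowP => k; rewrite [RHS]mxE.
apply: (freev (fun k => (U *m ME) 0 k)).
apply: (ae_imply _ (ae_forall_fin (P := fun o x => match o with
    | None => 0 < x -> \sum_i u i * f i x = 0
    | Some l => 0 < x -> f l x = \sum_j E l j * v j x end) (I := option 'I_n) _)); last by case.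
move=> x hx x0; rewrite -[RHS](hx None x0).
under [RHS]eq_bigr => j _ do rewrite (hx (Some j) x0) mulr_sumr.
rewrite [RHS]exchange_big; apply: eq_bigr => l _.
by rewrite mxE mulr_suml; apply: eq_bigr => j _; rewrite !mxE mulrA.
Qed.

(** Independence of f makes A invertible: a left kernel vector of A yields a
combination of the f_q with zero transform. The rows of the inverse of A, with
the sign that turns s^j into (- s)^j, give the functions whose transforms are
those of the iterates of x d/dx on om. *)
Lemma derivative_type_span (N : R) n (f : 'I_n.+1 -> R -> R) (om : R -> R)
    (A : 'M[R]_n.+1) : 1 < N ->
  (forall q, mellin_integrable N (f q)) -> mellin_integrable N om ->
  (forall q s, N <= s ->
     rmellin (f q) s = (\sum_l A q l * s ^+ l) * rmellin om s) ->
  ae_free f ->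
  exists omega : R -> R,
    [/\ MDT_regular n.+1 omega, {ae mu, forall x, 0 < x -> om x = omega x}
      & span_ae f = span_ae (fun j : 'I_n.+1 => iter j xD omega)].
Proof.
move=> N1 mf mom Mf freef.
have Au : A \in unitmx.
  rewrite unitmxE unitfE; apply/det0P => -[u u0 uA].
  have [msum Msum] := mellin_sum (index_enum 'I_n.+1) (u 0) mf.
  suff uz : forall q, u 0 q = 0 by case/eqP: u0; apply/rowP => q; rewrite uz mxE.
  apply: freef; apply: (rmellin_inj msum) => s Ns; rewrite Msum//.
  under eq_bigr => q _ do rewrite Mf// mulrA mulr_sumr.
  rewrite -mulr_suml exchange_big/=.
  rewrite big1 ?mul0r// => l _; under eq_bigr do rewrite mulrA.
  have /rowP/(_ l) := uA; rewrite !mxE => e.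
  by rewrite -mulr_suml e mul0r.
pose B := invmx A.
pose F (j : 'I_n.+1) x := \sum_q ((-1) ^+ j * B j q) * f q x.
have mF j : mellin_integrable N (F j).
  by have [] := mellin_sum (index_enum 'I_n.+1) (fun q => (-1) ^+ j * B j q) mf.
have MF j s : N <= s -> rmellin (F j) s = (- s) ^+ j * rmellin om s.
  move=> Ns; have [_ ->//] := mellin_sum (index_enum 'I_n.+1) (fun q => (-1) ^+ j * B j q) mf.
  under eq_bigr => q _ do rewrite Mf// mulrA mulr_sumr.
  rewrite -mulr_suml exchange_big/=; congr (_ * _).
  rewrite (bigD1 j)//= [X in _ + X]big1 ?addr0.
    under eq_bigr do rewrite mulrA -mulrA mulrA -[_ * _ * A _ _]mulrA.
    rewrite -mulr_suml -mulr_sumr.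
    have /matrixP/(_ j j) := mulVmx Au; rewrite !mxE eqxx => ->.
    by rewrite mulr1 -exprMn mulN1r.
  move=> l lj.
  under eq_bigr do rewrite mulrA -[_ * _ * A _ _]mulrA.
  rewrite -mulr_suml -mulr_sumr.
  have /matrixP/(_ j l) := mulVmx Au; rewrite !mxE eq_sym (negbTE lj) => ->.
  by rewrite mulr0 mul0r.
pose G (j : nat) := F (inord j).
have mG j : (j <= n)%N -> mellin_integrable N (G j) by move=> _; exact: mF.
have MG j s : (j <= n)%N -> N <= s -> rmellin (G j) s = (- s) ^+ j * rmellin (G 0) s.
  by move=> jn Ns; rewrite /G !MF// !inordK// expr0 mul1r.
have [omega regom hom] := regular_representative N1 mG MG.
exists omega; split=> //.
  have e0 : {ae mu, forall x, 0 < x -> om x = G 0 x}.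
    apply: (rmellin_inj_eq mom (mG _ (leq0n _))) => s Ns.
    by rewrite /G MF// inordK// expr0 mul1r.
  apply: (ae_imply _ (ae_forall_fin (I := bool) (P := fun b x =>
    if b then 0 < x -> om x = G 0 x else 0 < x -> iter 0 xD omega x = G 0 x) _));
    last by case=> //; exact: hom.
  by move=> x hx x0; rewrite (hx true x0) -(hx false x0).
have signM (l : nat) (y z t : R) : y * z * t = y * (-1) ^+ l * ((-1) ^+ l * z * t).
  have : (-1) ^+ l * (-1) ^+ l = 1 :> R by rewrite -expr2 sqrr_sign.
  by move: ((-1) ^+ l) => e ee; rewrite -[y in LHS]mulr1 -ee; ring.
transitivity (span_ae F).
  apply/seteqP; split; apply: span_ae_sub => j.
    exists (fun l => A j l * (-1) ^+ l); apply: aeW => x _.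
    under eq_bigr do rewrite mulr_sumr.
    rewrite exchange_big/= (bigD1 j)//= [X in _ + X]big1 ?addr0.
      have /matrixP/(_ j j) := mulmxV Au; rewrite !mxE eqxx => e.
      rewrite -[LHS]mul1r -[X in X * _ = _]e mulr_suml; apply: eq_bigr => l _.
      exact: signM.
    move=> q qj; have /matrixP/(_ j q) := mulmxV Au.
    rewrite !mxE eq_sym (negbTE qj) => e.
    rewrite -[RHS](mul0r (f q x)) -[X in _ = X * _]e mulr_suml; apply: eq_bigr => l _.
    exact/esym/signM.
  by exists (fun q => (-1) ^+ j * B j q); apply: aeW.
apply/esym/eq_span_ae => j.
apply: ae_imply (hom j (leq_ord j)) => x h x0.
by rewrite h// /G inord_val.
Qed.

End Spans.

(** * Real and imaginary parts of the Mellin transform *)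

Section ComplexMellin.
Context {R : realType}.
Local Notation mu := (@lebesgue_measure R).
Local Notation D := (`]0, +oo[%classic : set R).
Implicit Type z : R[i].

Lemma Re_sum (I : Type) (s : seq I) (F : I -> R[i]) :
  complex.Re (\sum_(i <- s) F i) = \sum_(i <- s) complex.Re (F i).
Proof. by elim: s => [|i s ih]; rewrite ?big_nil// !big_cons Re_add ih. Qed.

Lemma ReM_real z (x : R) : complex.Re (z * x%:C) = complex.Re z * x.
Proof. by case: z => u v /=; rewrite mulr0 subr0. Qed.

Lemma ImM_real z (x : R) : complex.Im (z * x%:C) = complex.Im z * x.
Proof. by case: z => u v /=; rewrite mulr0 add0r. Qed.

Lemma L1_mellin_integrable (Sigma : set R) (N : R) (g : R -> R[i]) :
  (forall s, N <= s -> Sigma s) -> L1_mellin Sigma g ->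
  mellin_integrable N (fun x => complex.Re (g x)) /\
  mellin_integrable N (fun x => complex.Im (g x)).
Proof.
move=> SN [mRe mIm int].
have mp s : measurable_fun D (fun x : R => x `^ (s - 1)).
  by apply: measurable_funTS; exact: measurable_powR.
have key (h : R -> R) : measurable_fun D h ->
    (forall x, `|h x| <= ComplexField.Normc.normc (g x)) -> mellin_integrable N h.
  move=> mh hg; split=> // s Ns; apply/integrableP; split.
    by apply/measurable_EFinP; exact (measurable_funM mh (mp s)).
  apply: le_lt_trans (int s (SN s Ns)); apply: ge0_le_integral => //.
  - apply/measurable_EFinP; apply: measurableT_comp => //; exact (measurable_funM mh (mp s)).
  - apply/measurable_EFinP.
    rewrite (_ : (fun x => _) = fun x => Num.sqrt ((complex.Re (g x) * x `^ (s - 1)) ^+ 2 +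
        (complex.Im (g x) * x `^ (s - 1)) ^+ 2)); last first.
      by apply/funext => x; rewrite -ReM_real -ImM_real; case: (_ * _).
    apply: measurableT_comp.
      by apply: continuous_measurable_fun; exact: sqrt_continuous.
    apply: measurable_funD; apply: measurable_funX.
      exact (measurable_funM mRe (mp s)).
    exact (measurable_funM mIm (mp s)).
  - move=> x _; rewrite lee_fin ComplexField.Normc.normcM normrM.
    apply: ler_pM => //; rewrite /= expr0n/= addr0 sqrtr_sqr//.
by split; apply: key => // x; case: (g x) => u v /=;
  rewrite -sqrtr_sqr ler_sqrt ?addr_ge0 ?sqr_ge0// ?lerDl ?lerDr sqr_ge0.
Qed.

Lemma mellinE (g : R -> R[i]) (s : R) :
  mellin g s = rmellin (fun x => complex.Re (g x)) s +i*
               rmellin (fun x => complex.Im (g x)) s.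
Proof.
by congr (_ +i* _); apply: eq_Rintegral => x _; rewrite (ReM_real, ImM_real).
Qed.

Lemma mellin_real (f : R -> R) (s : R) :
  mellin (fun x => (f x)%:C) s = (rmellin f s)%:C.
Proof. by rewrite mellinE /= rmellin0. Qed.

End ComplexMellin.

(** * Quotients of Gamma functions as polynomials *)

Section GammaQuotient.
Context {R : realType}.
Local Notation C := R[i].

Lemma size_mul_leS (p q : {poly C}) (m n : nat) :
  (size p <= m.+1)%N -> (size q <= n.+1)%N -> (size (p * q)%R <= (m + n).+1)%N.
Proof.
move=> pm qn; apply: (leq_trans (size_polyMleq _ _)).
by rewrite -subn1 leq_subLR; apply: (leq_trans (leq_add pm qn)); lia.
Qed.

Lemma size_prod_leS (I : Type) (s : seq I) (F : I -> {poly C}) (m : I -> nat) :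
  (forall i, size (F i) <= (m i).+1)%N ->
  (size (\prod_(i <- s) F i)%R <= (\sum_(i <- s) m i).+1)%N.
Proof.
move=> Fm; elim: s => [|i s ih]; first by rewrite !big_nil size_poly1.
by rewrite !big_cons; exact: size_mul_leS.
Qed.

Lemma size_prod_XaddC (m n : nat) (f : nat -> C) :
  (size (\prod_(m <= l < n) ('X + (f l)%:P))%R <= (n - m).+1)%N.
Proof.
have := size_prod_leS (index_iota m n) (m := fun=> 1%N) (F := fun l => 'X + (f l)%:P) _.
by rewrite sum_nat_const_nat muln1; apply => l; rewrite size_XaddC.
Qed.

Lemma size_exp_bool (p : {poly C}) (m : nat) (d : bool) :
  (size p <= m.+1)%N -> (size (p ^+ d)%R <= (d * m).+1)%N.
Proof. by case: d => pm; rewrite ?expr1 ?mul1n// expr0 mul0n size_poly1. Qed.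

(** One factor i of the quotient of the transform of x^k w_j by that of om; the
boolean e is the condition i <= j, under which the denominator carries the extra
factor s + k + b, i.e. Gamma (s + k + b) moves up to Gamma (s + k + b + 1). The
climb from there to s + b + n leaves the factors from k + e to n. Only these
linear factors, which are nonzero, are cancelled; the Gamma values are carried
along. *)
Lemma gamma_quotient (a : C) (b s : R) (d1 d2 e : bool) (k n : nat) :
  0 < complex.Re (s%:C + a) -> 0 < s + b -> (k + e <= n)%N ->
  Gamma ((s + k%:R)%:C + a) ^+ d1 / Gamma (s + k%:R + b)%:C ^+ d2 /
    (if e then ((s + k%:R + b) ^+ d2)%:C else 1) =
  (\prod_(0 <= l < k) (s%:C + (a + l%:R))) ^+ d1 *
  (\prod_(k + e <= l < n) (s%:C + (b%:C + l%:R))) ^+ d2 *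
  (Gamma (s%:C + a) ^+ d1 / Gamma (s + b + n%:R)%:C ^+ d2).
Proof.
move=> sa sb ken.
have kC (j : nat) : (j%:R : R)%:C = j%:R :> C by rewrite rmorph_nat.
have numer : Gamma ((s + k%:R)%:C + a) =
    (\prod_(0 <= l < k) (s%:C + (a + l%:R))) * Gamma (s%:C + a).
  rewrite rmorphD /= kC addrAC (Gamma_addn sa (leq0n k)) addr0.
  by congr (_ * _); apply: eq_bigr => l _; rewrite addrA.
have sbC : 0 < complex.Re (s + b)%:C by [].
have den0 l : (s + b)%:C + l%:R != 0 :> C.
  by apply: Re_gt0_neq0; rewrite Re_add Re_nat ltr_wpDr.
have denom : Gamma (s + b + n%:R)%:C =
    (\prod_(k + e <= l < n) (s%:C + (b%:C + l%:R))) *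
    (Gamma (s + k%:R + b)%:C * (if e then (s + k%:R + b)%:C else 1)).
  rewrite rmorphD /= kC (Gamma_addn sbC ken).
  congr (_ * _); first by apply: eq_bigr => l _; rewrite rmorphD addrA.
  have -> : (s + k%:R + b)%:C = (s + b)%:C + k%:R by rewrite addrAC rmorphD /= kC.
  case: (e); last by rewrite addn0 mulr1.
  by rewrite addn1 -natr1 addrA Gamma_succ 1?mulrC// Re_add Re_nat ltr_wpDr.
have prod0 : \prod_(k + e <= l < n) (s%:C + (b%:C + l%:R)) != 0 :> C.
  rewrite prodf_seq_neq0; apply/allP => l _; apply/implyP => _.
  by rewrite addrA -rmorphD den0.
rewrite numer exprMn_comm; last exact: mulrC.
case: d2; last by rewrite !expr0 mulr1 divr1 !divr1; case: e {ken denom prod0}; rewrite ?divr1.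
rewrite !expr1 denom; move: prod0; set Q := \prod_(_ <= _ < _) _ => Q0.
set E := if e then _ else _; rewrite !invfM.
have := mulfV Q0; move: (Q^-1) (_^-1) (E^-1) (_ ^+ d1) (_ ^+ d1) => Qi gi Ei X G QQ.
by rewrite -[LHS]mulr1 -QQ; ring.
Qed.

End GammaQuotient.

(** * The transforms of the weights over that of the derivative type *)

Section MellinRatio.
Context {R : realType}.
Local Notation C := R[i].
Variables (r : nat) (nn : 'I_r -> nat) (hnn : step_line nn).
Variables (a : 'I_r -> C) (b : 'I_r -> R) (c : R) (hc : 0 < c) (d1 d2 : 'I_r -> bool).

Lemma sum_ord_le (j : 'I_r) : (\sum_(i < r) ((i <= j)%N : nat) = j.+1)%N.
Proof.
rewrite -[RHS]card_ord -sum1_card (big_ord_widen r (fun=> 1%N) (ltn_ord j)).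
by rewrite [RHS]big_mkcond; apply: eq_bigr => i _; rewrite ltnS; case: leqP.
Qed.

(** For i <= j monotonicity gives k + 1 <= n_j <= n_i; for i > j the components of
the step line drop by at most one. *)
Lemma step_line_offset (j i : 'I_r) (k : nat) : (k < nn j)%N ->
  (k + (i <= j) <= nn i)%N.
Proof.
move=> kj; have := step_line_diff j i hnn.
by have := hnn.1 i j; case: (i <= j)%N => [/(_ isT)|_]; lia.
Qed.

(** Degree count: in the factor i, the numerator contributes k linear factors and
the denominator n_i - k - [i <= j]. Together these are at most n_i - [i <= j]
(when one of the two is absent as well, by [step_line_offset]), and the sum over
i of [i <= j] is j + 1, one more than the degree of (s + k)^j. *)
Lemma mellin_ratio (j : 'I_r) (k : nat) : (k < nn j)%N ->
  exists2 P : {poly C}, (size P <= \sum_(i < r) nn i)%N &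
  forall s : R, (forall i, 0 < complex.Re (s%:C + a i)) -> (forall i, 0 < s + b i) ->
  (c `^ (s + k%:R))%:C
  * (\prod_(i < r) (Gamma ((s + k%:R)%:C + a i) ^+ d1 i
                    / Gamma (s + k%:R + b i)%:C ^+ d2 i))
  * (((s + k%:R) ^+ j)%:C / \prod_(i < r | (i <= j)%N) ((s + k%:R + b i) ^+ d2 i)%:C) =
  P.[s%:C] * ((c `^ s)%:C
     * \prod_(i < r) (Gamma (s%:C + a i) ^+ d1 i
                      / Gamma (s + b i + (nn i)%:R)%:C ^+ d2 i)).
Proof.
move=> kj.
pose U (i : 'I_r) : {poly C} := \prod_(0 <= l < k) ('X + (a i + l%:R)%:P).
pose V (i : 'I_r) : {poly C} := \prod_(k + (i <= j) <= l < nn i) ('X + ((b i)%:C + l%:R)%:P).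
pose W := \prod_(i < r) (U i ^+ d1 i * V i ^+ d2 i).
exists ((c ^+ k)%:C%:P * W * ('X + (k%:R : C)%:P) ^+ j).
  have sU (i : 'I_r) : (size (U i ^+ d1 i)%R <= (d1 i * k).+1)%N.
    by apply: size_exp_bool; have := size_prod_XaddC 0 k (fun l => a i + l%:R); rewrite subn0.
  have sV (i : 'I_r) : (size (V i ^+ d2 i)%R <= (d2 i * (nn i - (k + (i <= j)))).+1)%N.
    by apply: size_exp_bool; exact: size_prod_XaddC.
  have sW := size_prod_leS (index_enum 'I_r) (fun i => size_mul_leS (sU i) (sV i)).
  have sc : (size ((c ^+ k)%:C%:P : {poly C}) <= 1)%N by exact: size_polyC_leq1.
  have sX : (size (('X + (k%:R : C)%:P) ^+ j)%R <= j.+1)%N.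
    have := size_prod_leS (index_enum 'I_j) (m := fun=> 1%N) (F := fun=> 'X + (k%:R : C)%:P) _.
    by rewrite prodr_const sum_nat_const card_ord muln1; apply=> _; rewrite size_XaddC.
  apply: (leq_trans (size_mul_leS (size_mul_leS sc sW) sX)).
  rewrite add0n -addnS -(sum_ord_le j) -big_split/=; apply: leq_sum => i _.
  by have := step_line_offset i kj; case: (d1 i) (d2 i) => -[]; lia.
move=> s sa sb.
rewrite !hornerM hornerC horner_exp hornerD hornerX hornerC horner_prod.
under [X in _ = _ * X * _ * _]eq_bigr => i _ do rewrite hornerM !horner_exp !horner_prod.
have kC : (k%:R : R)%:C = k%:R :> C by rewrite rmorph_nat.
have -> : (c `^ (s + k%:R))%:C = (c `^ s)%:C * (c ^+ k)%:C.
  by rewrite powRD ?(gt_eqF hc) ?implybT// powR_mulrn ?(ltW hc)// rmorphM.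
have -> : ((s + k%:R) ^+ j)%:C = (s%:C + k%:R) ^+ j by rewrite rmorphXn rmorphD /= kC.
have e : \prod_(i < r) (Gamma ((s + k%:R)%:C + a i) ^+ d1 i
                    / Gamma (s + k%:R + b i)%:C ^+ d2 i)
   / (\prod_(i < r | (i <= j)%N) ((s + k%:R + b i) ^+ d2 i)%:C) =
   (\prod_(i < r) ((U i).[s%:C] ^+ d1 i * (V i).[s%:C] ^+ d2 i)) *
   (\prod_(i < r) (Gamma (s%:C + a i) ^+ d1 i
                      / Gamma (s + b i + (nn i)%:R)%:C ^+ d2 i)).
  rewrite [X in _ / X]big_mkcond -prodf_div -big_split/=; apply: eq_bigr => i _.
  rewrite (gamma_quotient _ _ (sa i) (sb i) (step_line_offset i kj)).
  rewrite /U /V !horner_prod; congr (_ ^+ _ * _ ^+ _ * _); apply: eq_bigr => l _;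
    by rewrite hornerD hornerX hornerC.
move: e; rewrite /U /V.
under [X in _ = X * _ -> _]eq_bigr => i _ do rewrite !horner_prod.
set G1 := \prod_(i < r) _; set G2 := \prod_(i < r | _) _; set G3 := \prod_(i < r) _.
set G4 := \prod_(i < r) _ => e.
by rewrite !mulrA -[_ / G2]mulrA; move: e; move: (G2^-1) => g2 e; ring: e.
Qed.

End MellinRatio.

(** * Multiplication by powers of x *)

Section MellinShift.
Context {R : realType}.
Local Notation mu := (@lebesgue_measure R).
Local Notation D := (`]0, +oo[%classic : set R).

Lemma mellin_shift (N : R) (f : R -> R) (k : nat) : mellin_integrable N f ->
  mellin_integrable N (fun x => x ^+ k * f x) /\
  forall s : R, rmellin (fun x => x ^+ k * f x) s = rmellin f (s + k%:R).
Proof.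
move=> [mf intf].
have e s x : x \in D -> f x * x `^ (s + k%:R - 1) = x ^+ k * f x * x `^ (s - 1).
  rewrite inE in_D => x0; rewrite addrAC powRD; last by rewrite (gt_eqF x0) implybT.
  by rewrite powR_mulrn ?(ltW x0)//; ring.
split; last by move=> s; apply: eq_Rintegral => x xD; rewrite e.
split; first by apply: measurable_funM => //; exact: measurable_funX.
move=> s Ns; have Nsk : N <= s + k%:R by rewrite (le_trans Ns)// lerDl.
have := intf _ Nsk; apply: eq_integrable => // x xD.
by rewrite /= e.
Qed.

Lemma card_MOPE (r : nat) (nn : 'I_r -> nat) :
  #|{: {j : 'I_r & 'I_(nn j)}}| = (\sum_(j < r) nn j)%N.
Proof.
rewrite card_tagged sumnE big_map big_enum /=.
by apply: eq_bigr => j _; rewrite card_ord.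
Qed.

End MellinShift.

Theorem proposition2p1 (R : realType) (Sigma : set R)
    (hSigma : mellin_domain Sigma)
    (n r : nat) (hn : (1 <= n)%N) (hr : (1 <= r)%N)
    (nn : 'I_r -> nat) (hnn : step_line nn)
    (hsum : (\sum_(i < r) nn i)%N = n)
    (a : 'I_r -> R[i]) (b : 'I_r -> R) (c : R) (hc : 0 < c)
    (d1 d2 : 'I_r -> bool)
    (hd : (forall i, d1 i) \/ (forall i, d2 i))
    (w : 'I_r -> R -> R)
    (hw : forall j, L1_mellin Sigma (fun x => (w j x)%:C))
    (hMw : forall (j : 'I_r) (s : R), Sigma s ->
       (forall i, d1 i -> ~ Gamma_pole (s%:C + a i)) ->
       (forall i : 'I_r, (i <= j)%N -> d2 i -> s + b i != 0) ->
       mellin (fun x => (w j x)%:C) s =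
         (c `^ s)%:C
         * (\prod_(i < r) (Gamma (s%:C + a i) ^+ d1 i
                           / Gamma (s + b i)%:C ^+ d2 i))
         * ((s ^+ j)%:C / \prod_(i < r | (i <= j)%N) ((s + b i) ^+ d2 i)%:C))
    (om : R -> R[i]) (hom : L1_mellin Sigma om)
    (hMom : forall s : R, Sigma s ->
       (forall i, d1 i -> ~ Gamma_pole (s%:C + a i)) ->
       mellin om s =
         (c `^ s)%:C
         * \prod_(i < r) (Gamma (s%:C + a i) ^+ d1 i
                          / Gamma (s + b i + (nn i)%:R)%:C ^+ d2 i))
    (hPE : exists v : 'I_n -> R -> R, is_MOPE w v) :
  forall v : 'I_n -> R -> R, is_MOPE w v <-> is_PE_MDT om v.
Proof.
case: n hn hsum hPE => [//|n] _ hsum hPE.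
have Sig s : 1 <= s -> Sigma s.
  move=> s1; have [iS _ natS] := hSigma.
  apply: (iS 1 (Num.bound s)%:R); [exact: (natS 1%N)| |].
    apply: natS; rewrite -(ltr0n R) (lt_trans _ (archi_boundP _)) ?(lt_le_trans _ s1)//.
    exact: le_trans s1.
  by rewrite s1 ltW// archi_boundP// (le_trans _ s1).
(* beyond N every s + a_i has positive real part, every s + b_i is positive *)
pose N := 2 + (\sum_i `|complex.Re (a i)| + \sum_i `|b i|) : R.
have term (F : 'I_r -> R) i : `|F i| <= \sum_i `|F i|.
  by rewrite (bigD1 i)//= lerDl sumr_ge0.
have sum0 (F : 'I_r -> R) : 0 <= \sum_i `|F i| by rewrite sumr_ge0.
have N1 : 1 < N.
  by rewrite /N; have := sum0 b; have := sum0 (fun i => complex.Re (a i)); lra.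
have SN s : N <= s -> Sigma s by move=> Ns; apply: Sig; exact: le_trans (ltW N1) Ns.
have sa s i : N <= s -> 0 < complex.Re (s%:C + a i).
  rewrite Re_add /= => Ns; have := term (fun i => complex.Re (a i)) i.
  have := sum0 b; have := ler_norm (- complex.Re (a i)); rewrite normrN /=.
  by move: Ns; rewrite /N; lra.
have sb s i : N <= s -> 0 < s + b i.
  move=> Ns; have := term b i; have := sum0 (fun i => complex.Re (a i)).
  by have := ler_norm (- b i); rewrite normrN; move: Ns; rewrite /N; lra.
have nopole s i : N <= s -> ~ Gamma_pole (s%:C + a i).
  move=> Ns [m e]; have := sa s i Ns; rewrite e.
  have -> : complex.Re (- (m%:R : R[i])) = - m%:R by rewrite -Re_nat; case: (m%:R).
  by rewrite oppr_gt0 ltNge ler0n.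
have mw j : mellin_integrable N (w j) by have [] := L1_mellin_integrable SN (hw j).
have [mRe mIm] := L1_mellin_integrable SN hom.
have Mw j s : N <= s -> (rmellin (w j) s)%:C = (c `^ s)%:C
    * (\prod_(i < r) (Gamma (s%:C + a i) ^+ d1 i / Gamma (s + b i)%:C ^+ d2 i))
    * ((s ^+ j)%:C / \prod_(i < r | (i <= j)%N) ((s + b i) ^+ d2 i)%:C).
  move=> Ns; rewrite -mellin_real hMw//; first exact: SN.
    by move=> i _; exact: nopole.
  by move=> i _ _; rewrite gt_eqF// sb.
have Mom s : N <= s -> mellin om s = (c `^ s)%:C
    * \prod_(i < r) (Gamma (s%:C + a i) ^+ d1 i / Gamma (s + b i + (nn i)%:R)%:C ^+ d2 i).
  move=> Ns; rewrite hMom//; first exact: SN.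
  by move=> i _; exact: nopole.
(* om is real: its transform is that of the real weight w_0 times a real
   rational function *)
have Im0 s : N <= s -> rmellin (fun x => complex.Im (om x)) s = 0.
  move=> Ns; pose j0 := Ordinal hr.
  pose Q := \prod_(i < r) (\prod_(0 <= l < nn i) (s + (b i + l%:R))) ^+ d2 i.
  pose E := \prod_(i < r | (i <= j0)%N) (s + b i) ^+ d2 i.
  have Q0 : Q != 0.
    apply/prodf_neq0 => i _; rewrite expf_eq0 negb_and; apply/orP; right.
    rewrite prodf_seq_neq0; apply/allP => l _ /=; rewrite addrA gt_eqF//.
    by rewrite ltr_wpDr ?sb.
  have E0 : E != 0 by apply/prodf_neq0 => i _; rewrite expf_neq0// gt_eqF// sb.
  suff e : mellin om s = (rmellin (w j0) s * E / Q)%:C.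
    by have := mellinE om s; rewrite e => -[_ <-].
  have quot : \prod_(i < r) (Gamma (s%:C + a i) ^+ d1 i / Gamma (s + b i)%:C ^+ d2 i) =
      Q%:C * \prod_(i < r) (Gamma (s%:C + a i) ^+ d1 i
                            / Gamma (s + b i + (nn i)%:R)%:C ^+ d2 i).
    rewrite rmorph_prod -big_split; apply: eq_bigr => i _ /=.
    have := gamma_quotient (d1 i) (d2 i) (e := false) (k := 0)
      (sa s i Ns) (sb s i Ns) (leq0n (nn i)).
    rewrite !addr0 divr1 big_geq// expr1n mul1r => ->; congr (_ * _).
    rewrite rmorphXn rmorph_prod /=; congr (_ ^+ _).
    by apply: eq_bigr => l _; rewrite !rmorphD /= rmorph_nat.
  have E0C : E%:C != 0 :> R[i] by rewrite fmorph_eq0.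
  have Q0C : Q%:C != 0 :> R[i] by rewrite fmorph_eq0.
  have := Mw j0 s Ns; rewrite expr0 quot -rmorph_prod /= -/E Mom// => w0.
  rewrite rmorphM fmorphV rmorphM /= w0 rmorph1; move: (Q%:C) (E%:C) Q0C E0C => QC EC Q0C E0C.
  by field; rewrite Q0C E0C.
pose om0 x := complex.Re (om x).
have Mom0 s : N <= s -> mellin om s = (rmellin om0 s)%:C.
  by move=> Ns; rewrite mellinE Im0.
have om_real := rmellin_inj mIm Im0.
pose W := @MOPE_family R r nn w.
have mW p : mellin_integrable N (W p).
  by have [] := mellin_shift (tagged p) (mw (tag p)).
have ratio p : exists A : nat -> R, forall s, N <= s ->
    rmellin (W p) s = (\sum_(l < n.+1) A l * s ^+ l) * rmellin om0 s.
  case: p => j k; have [P sP hP] := mellin_ratio hnn a b hc d1 d2 (ltn_ord k).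
  exists (fun l => complex.Re P`_l) => s Ns.
  have Nsk : N <= s + k%:R by rewrite (le_trans Ns)// lerDl.
  have eW : (rmellin (W (Tagged (fun j => 'I_(nn j)) k)) s)%:C = P.[s%:C] * (rmellin om0 s)%:C.
    have [_ ->] := mellin_shift k (mw j).
    rewrite Mw// -Mom0// Mom//; apply: hP => i; [exact: sa|exact: sb].
  have -> : rmellin (W (Tagged (fun j => 'I_(nn j)) k)) s =
      complex.Re (P.[s%:C] * (rmellin om0 s)%:C) by rewrite -eW.
  rewrite ReM_real; congr (_ * _).
  rewrite (horner_coef_wide _ (n := n.+1)) -?hsum//.
  rewrite Re_sum; apply: eq_bigr => l _.
  by rewrite -rmorphXn /= ReM_real.
have [A hA] := choice ratio.
have cardI : #|{: {j : 'I_r & 'I_(nn j)}}| = n.+1 by rewrite card_MOPE.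
pose e (q : 'I_n.+1) : {j : 'I_r & 'I_(nn j)} := enum_val (cast_ord (esym cardI) q).
have bij_e : bijective e.
  exists (fun p => cast_ord cardI (enum_rank p)) => [q|p].
    by rewrite /e enum_valK cast_ordKV.
  by rewrite /e cast_ordK enum_rankK.
pose f q := W (e q).
have spanf : span_ae f = span_ae W by exact: reindex_span_ae.
have MOPE_nn (v : 'I_n.+1 -> R -> R) : is_MOPE w v ->
    is_PE (fun j => zero_ext (v j)) /\ span_ae v = span_ae W.
  move=> [PEv [mm [smm summ spanv]]]; split=> //; rewrite spanv.
  have mmE : mm = nn := step_line_inj smm hnn (etrans summ (esym hsum)).
  by rewrite /W -mmE.
have freef : ae_free f.
  have [v /MOPE_nn[PEv spanv]] := hPE.
  by apply: (ae_free_span (is_PE_free PEv)); rewrite spanv spanf.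
pose M : 'M[R]_n.+1 := \matrix_(q, l) A (e q) l.
have Mf q s : N <= s -> rmellin (f q) s = (\sum_l M q l * s ^+ l) * rmellin om0 s.
  by move=> Ns; rewrite hA//; congr (_ * _); apply: eq_bigr => l _; rewrite mxE.
have [omega [regom omE spanE]] :=
  derivative_type_span N1 (fun q => mW (e q)) mRe Mf freef.
have om_omega : {ae lebesgue_measure, forall x : R, 0 < x -> om x = (omega x)%:C}.
  apply: (ae_imply _ (ae_forall_fin (I := bool) (P := fun b x =>
    if b then 0 < x -> complex.Re (om x) = omega x
    else 0 < x -> complex.Im (om x) = 0) _)); last by case.
  move=> x hx x0; move: (hx true x0) (hx false x0).
  by case: (om x) => u v /= -> ->.
move=> v; split=> [/MOPE_nn[PEv spanv]|[PEv [omega' om_omega' [regom' spanv]]]].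
  by split=> //; exists omega => //; split=> //; rewrite spanv -spanf.
split=> //; exists nn; split=> //; rewrite spanv -spanf spanE.
have omE' : {ae lebesgue_measure, forall x : R, 0 < x -> omega' x = omega x}.
  apply: (ae_imply _ (ae_forall_fin (I := bool) (P := fun b x =>
    if b then 0 < x -> om x = (omega x)%:C
    else 0 < x -> om x = (omega' x)%:C) _)); last by case.
  by move=> x hx x0; move: (hx false x0); rewrite (hx true x0) => -[].
apply: eq_span_ae => j; have [n0|n0] := posnP n.
  have -> : j = 0%N :> nat by case: j => j /=; rewrite n0 ltnS leqn0 => /eqP.
  exact: omE'.
apply: aeW => x; apply: iter_xD_eq.
exact: (MDT_regular_ae_eq regom' regom omE').
Qed.
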